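(* Let $X$ be a locally compact and second countable Hausdorff space, and $S$ a countable discrete semigroup with identity acting on $X$ from the right by continuous maps. Let $(X\rtimes S,\lambda)$ be the corresponding locally compact semigroupoid with quasi-Haar system $\lambda^x=\delta_x\times(\text{counting measure on }S)$. Then $(X\rtimes S,\lambda)$ is Liouville if and only if it is uniform Reiter.
   Context: A right action $(x,s)\mapsto x.s$ of $S$ on $X$ satisfies $x.e=x$ and $(x.s).t=x.(st)$. The semigroupoid $X\rtimes S$ is the small category with morphism set $X\times S$ (product topology), object set $X$, source $\mathbf s(x,s)=x.s$, target $\mathbf t(x,s)=x$ and composition $(x,s)(x.s,t)=(x,st)$; the fibre over $x$ is $\{x\}\times S$, identified with $S$. With these data the properties in question amount to the following. For a probability measure $\theta$ on $S$ and $s\in S$, $s\theta$ is the pushforward of $\theta$ under $t\mapsto st$; $\|\cdot\|$ is the total variation ($\ell^1$) norm. Uniform Reiter: there is a sequence $(\theta_n)_n$ of families $\theta_n=(\theta_n^x)_{x\in X}$ of probability measures on $S$ such that for every $n$ the map $x\in X\mapsto\theta_n^x\in\ell^1(S)$ is continuous, and for every $s\in S$, $\lim_{n\to\infty}\|\theta_n^x-s\theta_n^{x.s}\|=0$ uniformly for $x$ in compact subsets of $X$. Liouville: there is a family $\pi=(\pi_x)_{x\in X}$ of probability measures on $S$ with $x\in X\mapsto\pi_x\in\ell^1(S)$ continuous such that for every $x\in X$, every $f\in\ell^\infty(S)$ (complex-valued) satisfying $f(r)=\sum_{s\in S}f(rs)\,\pi_{x.r}(s)$ for all $r\in S$ is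 constant. *)

(* Defs.v *)
From HB Require Import structures.
From mathcomp Require Import all_boot all_order all_algebra.
From mathcomp Require Import complex.
From mathcomp Require Import all_classical all_reals all_analysis.

Set Implicit Arguments.
Unset Strict Implicit.
Unset Printing Implicit Defensive.

Import Order.TTheory GRing.Theory Num.Theory.
Import numFieldNormedType.Exports.

Local Open Scope classical_set_scope.
Local Open Scope ring_scope.

(* Measures on a countable discrete set are represented by their mass
   functions p : S -> R. *)
Section ell1.
Context {R : realType} {S : choiceType}.

Definition is_prob (p : S -> R) : Prop :=
  (forall s, 0 <= p s) /\ (\esum_(s in [set: S]) (p s)%:E)%E = 1%E.

(* The junk value of [fine] is only taken when p is not summable. *)
Definition l1norm (p : S -> R) : R :=
  fine (\esum_(s in [set: S]) `|p s|%:E)%E.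

Definition l1_continuous {X : topologicalType} (p : X -> S -> R) : Prop :=
  forall x0 : X, l1norm (p x \- p x0) @[x --> x0] --> 0.

(* Sum of an absolutely summable family, as the difference of the sums of the
   positive and negative parts (the convention of [esumB]). *)
Definition rsum (g : S -> R) : R :=
  fine (\esum_(s in [set: S]) (Num.max (g s) 0)%:E
        - \esum_(s in [set: S]) (Num.max (- g s) 0)%:E)%E.

Definition csum (g : S -> R[i]) : R[i] :=
  (rsum (fun s => complex.Re (g s)) +i* rsum (fun s => complex.Im (g s)))%C.

Definition ell_infty (f : S -> R[i]) : Prop :=
  exists M : R, forall s, `|f s| <= M%:C%C.

End ell1.

Section transformation_semigroupoid.
Context (R : realType) (X : topologicalType) (S : monoidType).
Context (act : X -> S -> X).

(* Image of the measure p under t |-> s * t; left multiplication need not be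
   injective. *)
Definition ltranslate (s : S) (p : S -> R) : S -> R :=
  fun u => fine (\esum_(t in [set t | (s * t)%g = u]) (p t)%:E)%E.

Definition is_right_action : Prop :=
  (forall x, act x 1%g = x) /\
  (forall x s t, act (act x s) t = act x (s * t)%g).

Definition uniform_reiter : Prop :=
  exists theta : nat -> X -> S -> R,
    [/\ forall n x, is_prob (theta n x),
        forall n, l1_continuous (theta n) &
        forall s : S,
          {family compact,
            (fun n x =>
               l1norm (theta n x \- ltranslate s (theta n (act x s)))) @ \oo
            --> (fun _ : X => 0 : R)}].

(* f lives on the fibre {x} x S of X x| S; the arrow (x, r) has source x.r, so
   the weights at r are those of pi_(x.r). *)
Definition harmonic (pi : X -> S -> R) (x : X) (f : S -> R[i]) : Prop :=
  forall r : S, f r = csum (fun s => f (r * s)%g * (pi (act x r) s)%:C%C).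

Definition liouville : Prop :=
  exists pi : X -> S -> R,
    [/\ forall x, is_prob (pi x),
        l1_continuous pi &
        forall x (f : S -> R[i]), ell_infty f -> harmonic pi x f ->
          exists c, forall s, f s = c].

End transformation_semigroupoid.

(* Main.v *)
Require Import Defs.
From HB Require Import structures.
From mathcomp Require Import all_boot all_order all_algebra.
From mathcomp Require Import complex.
From mathcomp Require Import all_classical all_reals all_analysis.
From mathcomp Require Import finmap ring lra.
Import Order.TTheory GRing.Theory Num.Theory.
Import numFieldNormedType.Exports.
Local Open Scope classical_set_scope.
Local Open Scope ring_scope.

Set Implicit Arguments.
Unset Strict Implicit.
Unset Printing Implicit Defensive.

(** Fix a point x.  A family p of probability measures on S turns the fibre over
    x, identified with S, into a Markov chain which jumps from u to u t with
    probability p_(x.u)(t); its transition kernel is [fibre_kernel], and a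
    bounded function is harmonic on the fibre exactly when it is harmonic for this
    chain.  Since real and imaginary parts can be treated separately
    ([harmonicP]), all functions below are real.

    From Liouville to Reiter.  Let theta_n^x be the average of the laws of the
    first 2^n positions of the chain started at the identity.  Then
    theta_n^x - s theta_n^(x.s) is the image of the mass-zero measure
    delta_1 - delta_s under the Cesaro average A_n of the iterates
    T^0, ..., T^(2^n - 1) of the transition operator
    ([dyadic_avg_translate]).  The total variation of A_n mu tends to 0 for every
    mu of mass zero when bounded harmonic functions are constant
    ([dyadic_avg_cvg0]): if not, a cluster point of the functions dual to A_n mu
    is a bounded harmonic function which does not vanish on mu.  Averaging over
    powers of 2 has a second benefit: A_(n+1) = (A_n + T^(2^n) A_n) / 2, so these
    norms decrease in n.  They are also continuous in x, and Dini's argument makes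
    the convergence uniform on compact sets.

    From Reiter to Liouville.  Following Kaimanovich and Vershik, put
    p = sum_k 2^(-k-1) alpha_k, where alpha_k = theta_(N_k) for a rapidly chosen
    sequence N.  Split p into its head (k < m), of mass b < 1, and its tail, and
    let f be bounded and p-harmonic on the fibre over x.  With P the operator of
    the head, h = f - P f is the contribution of the tail.  Unrolling
    f = h + P f for n steps gives f(1) = <G, h> + O(b^n), where G is the measure
    of expected visits during the first n steps of the chain driven by the head
    ([green]).  If all the alpha_k with k >= m are almost invariant under a set E
    which carries G up to a small error, then h is almost constant on E, so that
    f(1) is close to a multiple of h(1); the multiple depends on m and n only,
    hence f(s) is close to the same multiple of h(s), and h(s) is close to h(1)
    ([mixture_oscillation]).  The set E can be chosen finite and uniformly for x
    in a compact set, because an l1-continuous family is uniformly tight on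
    compact sets ([l1_tight]).  As E depends on alpha_k for k < m only, N can be
    built recursively ([history_choice]) along an exhaustion of X by compact
    sets. *)

(** * Absolutely summable families *)

Section rsum_theory.
Context {R : realType} {S : choiceType}.
Implicit Types (p q : S -> R) (c : R).

Definition l1 p : Prop := (\esum_(s in [set: S]) `|p s|%:E < +oo)%E.

Lemma le_l1 p q : (forall s, `|p s| <= `|q s|) -> l1 q -> l1 p.
Proof.
move=> pq; apply: le_lt_trans; apply: le_esum => s _.
by rewrite lee_fin.
Qed.

Lemma l1D p q : l1 p -> l1 q -> l1 (fun s => p s + q s).
Proof.
move=> Dp Dq; apply: le_lt_trans (lte_add_pinfty Dp Dq).
rewrite -esumD//; try by move=> s _; rewrite lee_fin.
by apply: le_esum => s _; rewrite -EFinD lee_fin ler_normD.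
Qed.

Lemma l1N p : l1 p -> l1 (fun s => - p s).
Proof. by apply: le_l1 => s; rewrite normrN. Qed.

Lemma l1B p q : l1 p -> l1 q -> l1 (fun s => p s - q s).
Proof. by move=> ? ?; apply: l1D => //; exact: l1N. Qed.

Lemma l1_norm p : l1 p -> l1 (fun s => `|p s|).
Proof. by apply: le_l1 => s; rewrite normr_id. Qed.

Lemma l10 : l1 (fun=> 0).
Proof. by rewrite /l1 esum1 ?ltry// => s _; rewrite normr0. Qed.

Lemma esumZ c (a : S -> \bar R) : 0 <= c -> (forall s, 0 <= a s)%E ->
  (\esum_(s in [set: S]) (c%:E * a s) = c%:E * \esum_(s in [set: S]) a s)%E.
Proof.
have le d (b : S -> \bar R) : 0 <= d -> (forall s, 0 <= b s)%E ->
    (\esum_(s in [set: S]) (d%:E * b s) <= d%:E * \esum_(s in [set: S]) b s)%E.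
  move=> d0 b0; apply: ge_ereal_sup => _ [A [finA _] <-].
  rewrite -ge0_mule_fsumr// lee_wpmul2l ?lee_fin//.
  by apply: ereal_sup_ubound; exists A.
rewrite le_eqVlt => /predU1P[<-|c0] a0.
  by rewrite mul0e esum1// => s _; rewrite mul0e.
apply/eqP; rewrite eq_le le ?(ltW c0)//=.
rewrite muleC -lee_pdivlMr// muleC.
apply: le_trans (le _ _ _ _); last 2 first.
- by rewrite invr_ge0 ltW.
- by move=> s; rewrite mule_ge0// lee_fin ltW.
apply: le_esum => s _; rewrite muleA -EFinM mulVf ?gt_eqF//.
by rewrite mul1e.
Qed.

Lemma l1Z c p : l1 p -> l1 (fun s => c * p s).
Proof.
move=> hp; rewrite /l1; under eq_esum do rewrite normrM EFinM.
rewrite esumZ//.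
by rewrite lte_mul_pinfty ?lee_fin.
Qed.

Lemma l1Zr c p : l1 p -> l1 (fun s => p s * c).
Proof. by move=> /(l1Z c); apply: le_l1 => s; rewrite mulrC. Qed.

Lemma l1M (f : S -> R) c p : (forall s, `|f s| <= c) -> l1 p ->
  l1 (fun s => p s * f s).
Proof.
move=> fc /(l1Z c); apply: le_l1 => s; rewrite !normrM mulrC.
by rewrite ler_wpM2r// (le_trans (fc s)) ?ler_norm.
Qed.

Lemma esum_fin p : (forall s, 0 <= p s) -> l1 p ->
  (\esum_(s in [set: S]) (p s)%:E \is a fin_num)%E.
Proof.
move=> p0; rewrite /l1 ge0_fin_numE; last first.
  by apply: esum_ge0 => s _; rewrite lee_fin.
apply: le_lt_trans; apply: le_esum => s _.
by rewrite lee_fin ler_norm.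
Qed.

Lemma rsum_pos p : (forall s, 0 <= p s) ->
  rsum p = fine (\esum_(s in [set: S]) (p s)%:E)%E.
Proof.
move=> p0; rewrite /rsum [X in (_ - X)%E]esum1 ?sube0; last first.
  by move=> s _; rewrite max_r// oppr_le0.
by congr fine; apply: eq_esum => s _; rewrite max_l.
Qed.

Lemma rsum_pos_EFin p : (forall s, 0 <= p s) -> l1 p ->
  (rsum p)%:E = (\esum_(s in [set: S]) (p s)%:E)%E.
Proof. by move=> p0 lp; rewrite rsum_pos// fineK//; exact: esum_fin. Qed.

Lemma eq_rsum p q : p =1 q -> rsum p = rsum q.
Proof. by move=> /funext ->. Qed.

Lemma rsum_diff p q : (forall s, 0 <= p s) -> (forall s, 0 <= q s) ->
  l1 p -> l1 q -> rsum (fun s => p s - q s) = rsum p - rsum q.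
Proof.
move=> p0 q0 lp lq; rewrite (rsum_pos p0) (rsum_pos q0) -fineB ?esum_fin//.
rewrite -esumB//; last 2 first.
- by move=> s _; rewrite lee_fin.
- by move=> s _; rewrite lee_fin.
rewrite /rsum; congr fine; congr (_ - _)%E; apply: eq_esum => s _.
- by rewrite funeposE/= EFin_max.
- by rewrite funenegE/= EFin_max.
Qed.

(* Positive and negative parts reduce signed sums to sums of nonnegative terms. *)
Let pp p := fun s => Num.max (p s) 0.
Let pn p := fun s => Num.max (- p s) 0.
Let pp0 p s : 0 <= pp p s. Proof. by rewrite /pp le_max lexx orbT. Qed.
Let pn0 p s : 0 <= pn p s. Proof. by rewrite /pn le_max lexx orbT. Qed.
Let ppn p s : p s = pp p s - pn p s.
Proof.
by rewrite /pp /pn; case: (ltrP (p s) 0) => ?; case: (ltrP (- p s) 0); lra.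
Qed.
Let lpp p : l1 p -> l1 (pp p).
Proof.
apply: le_l1 => s; rewrite ger0_norm//.
by rewrite /pp; case: (ltrP (p s) 0) => // _; rewrite ler_norm.
Qed.
Let lpn p : l1 p -> l1 (pn p).
Proof.
apply: le_l1 => s; rewrite ger0_norm//.
by rewrite /pn; case: (ltrP (- p s) 0) => // _; rewrite -normrN ler_norm.
Qed.

Let rsumD_pos p q : (forall s, 0 <= p s) -> (forall s, 0 <= q s) ->
  l1 p -> l1 q -> rsum (fun s => p s + q s) = rsum p + rsum q.
Proof.
move=> p0 q0 lp lq; rewrite !rsum_pos//; last by move=> s; rewrite addr_ge0.
by rewrite -fineD ?esum_fin// -esumD//= => s _; rewrite lee_fin.
Qed.

Let rsumE p : l1 p -> rsum p = rsum (pp p) - rsum (pn p).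
Proof.
move=> lp; rewrite -rsum_diff; [by apply: eq_rsum => s; exact: ppn|by []|by []| |].
  exact: lpp.
exact: lpn.
Qed.

Lemma rsumD p q : l1 p -> l1 q ->
  rsum (fun s => p s + q s) = rsum p + rsum q.
Proof.
move=> lp lq; rewrite (rsumE lp) (rsumE lq).
rewrite (_ : rsum _ = rsum (fun s => (pp p s + pp q s) - (pn p s + pn q s))).
  rewrite rsum_diff; last 4 first.
  - by move=> s; rewrite addr_ge0.
  - by move=> s; rewrite addr_ge0.
  - by apply: l1D; exact: lpp.
  - by apply: l1D; exact: lpn.
  rewrite !rsumD_pos//; try exact: lpp; try exact: lpn.
  lra.
by apply: eq_rsum => s; rewrite (ppn p) (ppn q); lra.
Qed.

Lemma rsum0 : rsum (fun _ : S => 0 : R) = 0 :> R.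
Proof. by rewrite rsum_pos// esum1. Qed.

Lemma rsumN p : rsum (fun s => - p s) = - rsum p.
Proof.
have E r : rsum r = fine ((\esum_(s in [set: S]) (pp r s)%:E) -
                          (\esum_(s in [set: S]) (pn r s)%:E))%E by [].
rewrite !E.
rewrite (_ : pp (fun s => - p s) = pn p)//.
rewrite (_ : pn (fun s => - p s) = pp p); last first.
  by apply/funext => s; rewrite /pn opprK.
move: (\esum_(s in [set: S]) (pp p s)%:E)%E (\esum_(s in [set: S]) (pn p s)%:E)%E.
by move=> [x||] [y||] /=; rewrite ?oppr0//; lra.
Qed.

Lemma rsumB p q : l1 p -> l1 q ->
  rsum (fun s => p s - q s) = rsum p - rsum q.
Proof. by move=> lp lq; rewrite rsumD ?rsumN//; exact: l1N. Qed.

Lemma rsumZ c p : l1 p -> rsum (fun s => c * p s) = c * rsum p.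
Proof.
have pos d q : 0 <= d -> (forall s, 0 <= q s) -> l1 q ->
    rsum (fun s => d * q s) = d * rsum q.
  move=> d0 q0 lq; rewrite !rsum_pos//; last by move=> s; rewrite mulr_ge0.
  under eq_esum do rewrite EFinM.
  by rewrite esumZ// fineM// ?esum_fin.
have {}pos d q : 0 <= d -> l1 q -> rsum (fun s => d * q s) = d * rsum q.
  move=> d0 lq; rewrite (rsumE lq) mulrBr -!pos//; try exact: lpp; try exact: lpn.
  rewrite -rsumB.
  - by apply: eq_rsum => s; rewrite {1}(ppn q s) mulrBr.
  - exact/l1Z/lpp.
  - exact/l1Z/lpn.
move=> lp; have [c0|c0] := leP 0 c; first exact: pos.
rewrite -[LHS]opprK -rsumN (_ : rsum _ = rsum (fun s => (- c) * p s)).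
  by rewrite pos ?oppr_ge0 ?(ltW c0)// mulNr opprK.
by apply: eq_rsum => s; rewrite mulNr.
Qed.

Lemma rsumZr c p : l1 p -> rsum (fun s => p s * c) = rsum p * c.
Proof.
by move=> lp; rewrite mulrC -rsumZ//; apply: eq_rsum => s; rewrite mulrC.
Qed.

Lemma rsum_ge0 p : (forall s, 0 <= p s) -> 0 <= rsum p.
Proof.
by move=> p0; rewrite rsum_pos// fine_ge0// esum_ge0// => s _; rewrite lee_fin.
Qed.

Lemma le_rsum p q : l1 p -> l1 q -> (forall s, p s <= q s) -> rsum p <= rsum q.
Proof.
by move=> lp lq pq; rewrite -subr_ge0 -rsumB// rsum_ge0// => s; rewrite subr_ge0.
Qed.

Lemma l1normE p : l1norm p = rsum (fun s => `|p s|).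
Proof. by rewrite rsum_pos. Qed.

Lemma l1norm_ge0 p : 0 <= l1norm p.
Proof. by rewrite l1normE rsum_ge0. Qed.

Lemma norm_rsum p : l1 p -> `|rsum p| <= l1norm p.
Proof.
move=> lp; rewrite l1normE ler_norml; apply/andP; split.
  rewrite -rsumN; apply: le_rsum => //; first exact/l1N/l1_norm.
  by move=> s; rewrite lerNl -normrN ler_norm.
by apply: le_rsum => //; [exact: l1_norm|move=> s; rewrite ler_norm].
Qed.

Lemma l1normD p q : l1 p -> l1 q -> l1norm (p \+ q) <= l1norm p + l1norm q.
Proof.
move=> lp lq; rewrite !l1normE -rsumD; try exact: l1_norm.
apply: le_rsum => [||s]; [|by apply: l1D; exact: l1_norm|exact: ler_normD].
exact/l1_norm/l1D.
Qed.

Lemma l1normN p : l1norm (\- p) = l1norm p.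
Proof. by rewrite !l1normE; apply: eq_rsum => s; rewrite normrN. Qed.

Lemma l1normB p q : l1 p -> l1 q -> l1norm (p \- q) <= l1norm p + l1norm q.
Proof. by move=> lp lq; rewrite -(l1normN q); apply: l1normD => //; exact: l1N. Qed.

Lemma l1normZ c p : l1 p -> l1norm (fun s => c * p s) = `|c| * l1norm p.
Proof.
move=> lp; rewrite !l1normE -rsumZ; last exact: l1_norm.
by apply: eq_rsum => s; rewrite normrM.
Qed.

Lemma norm_rsumM p (f : S -> R) c : l1 p -> (forall s, `|f s| <= c) ->
  `|rsum (fun s => p s * f s)| <= c * l1norm p.
Proof.
move=> lp fc; apply: le_trans (norm_rsum (l1M fc lp)) _.
rewrite !l1normE -rsumZ; last exact: l1_norm.
apply: le_rsum => [||s]; [exact/l1_norm/l1M|exact/l1Z/l1_norm|].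
by rewrite normrM mulrC ler_wpM2r.
Qed.

Lemma esum_ge_point p a : (forall s, 0 <= p s) ->
  ((p a)%:E <= \esum_(s in [set: S]) (p s)%:E)%E.
Proof.
move=> p0; rewrite -(@esum_set1 _ _ a (fun s => (p s)%:E)) ?lee_fin//.
rewrite esum_mkcond; apply: le_esum => s _; case: ifP => // _.
by rewrite lee_fin.
Qed.

Lemma le_rsum_point p a : (forall s, 0 <= p s) -> l1 p -> p a <= rsum p.
Proof.
by move=> p0 lp; rewrite -lee_fin rsum_pos_EFin//; exact: esum_ge_point.
Qed.

Definition delta (a : S) : S -> R := fun s => (s == a)%:R.

Let esum_delta a : (\esum_(s in [set: S]) (delta a s)%:E = 1)%E.
Proof.
rewrite -(@esum_set1 R S a (fun=> 1%E)) ?lee_fin// [RHS]esum_mkcond.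
apply: eq_esum => s _; rewrite /delta; case: eqVneq => [->|sa].
  by rewrite mem_set.
by rewrite memNset// => /= sE; move: sa; rewrite sE eqxx.
Qed.

Lemma delta_prob a : is_prob (delta a).
Proof. by split; [move=> s; rewrite /delta ler0n|exact: esum_delta]. Qed.

Lemma prob_l1 p : is_prob p -> l1 p.
Proof.
move=> [p0 p1]; rewrite /l1; under eq_esum do rewrite ger0_norm//.
by rewrite p1 ltry.
Qed.

Lemma prob_rsum p : is_prob p -> rsum p = 1.
Proof. by move=> [p0 p1]; rewrite rsum_pos// p1. Qed.

Lemma prob_l1norm p : is_prob p -> l1norm p = 1.
Proof.
move=> hp; rewrite l1normE -(prob_rsum hp); apply: eq_rsum => s.
by rewrite ger0_norm//; case: hp.
Qed.

Definition has_mass b p := [/\ forall s, 0 <= p s, l1 p & rsum p = b].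

Lemma has_mass_l1norm b p : has_mass b p -> l1norm p = b.
Proof.
by move=> [p0 lp <-]; rewrite l1normE; apply: eq_rsum => s; rewrite ger0_norm.
Qed.

Lemma prob_mass p : is_prob p <-> has_mass 1 p.
Proof.
split=> [hp|[p0 lp p1]]; first by split; [case: hp|exact: prob_l1|exact: prob_rsum].
by split=> //; rewrite -rsum_pos_EFin// p1.
Qed.

Lemma l1_delta a : l1 (delta a).
Proof. exact/prob_l1/delta_prob. Qed.

Lemma rsum_delta a f : rsum (fun s => delta a s * f s) = f a.
Proof.
rewrite (_ : rsum _ = rsum (fun s => f a * delta a s)); last first.
  apply: eq_rsum => s; rewrite /delta; case: eqVneq => [->|_].
    by rewrite mulrC.
  by rewrite mul0r mulr0.
by rewrite rsumZ ?(prob_rsum (delta_prob a)) ?mulr1//; exact: l1_delta.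
Qed.

(** The sum of nonnegative terms is a supremum over finite sets, one of which
    nearly attains it. *)
Lemma l1_tail p e : (forall s, 0 <= p s) -> l1 p -> 0 < e ->
  exists2 A : set S, finite_set A &
    rsum (fun s => if s \in A then 0 else p s) < e.
Proof.
move=> p0 lp e0.
have ef := esum_fin p0 lp.
have [_ [A [finA _] <-]] := ub_ereal_sup_adherent e0 ef.
rewrite -/(esum _ _) => hA; exists A => //.
have lt : l1 (fun s => if s \in A then 0 else p s).
  by apply: le_l1 lp => s; case: ifP => // _; rewrite normr0.
rewrite -lte_fin rsum_pos_EFin//; last by move=> s; case: ifP.
move: hA; rewrite (esumID A setT) ?setTI//; last by move=> s _; rewrite lee_fin.
rewrite [X in (_ + X - _ < _)%E -> _]esum_mkcond.
rewrite (_ : (\esum_(i in [set: S]) (if i \in ~` A then (p i)%:E else 0) =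
   \esum_(s in [set: S]) (if s \in A then 0 else p s)%:E)%E); last first.
  by apply: eq_esum => s _; rewrite in_setC; case: (s \in A).
rewrite -esum_fset//; last by move=> s _; rewrite lee_fin.
have : (\esum_(i in A) (p i)%:E \is a fin_num)%E.
  move: ef; rewrite (esumID A setT) ?setTI; last by move=> s _; rewrite lee_fin.
  by rewrite fin_numD => /andP[].
have := esum_fin _ lt; have h s : 0 <= (if s \in A then 0 else p s) by case: ifP.
move=> /(_ h).
move: (\esum_(i in A) _)%E => [a||]//; move: (esum _ _) => [b||]// _ _.
rewrite -!EFinD !lte_fin; lra.
Qed.

End rsum_theory.

(** * Double sums and dominated convergence *)

Section double_sums.
Context {R : realType} {S T : choiceType}.
Implicit Types a : S -> T -> R.

Lemma exchange_esum (a : S -> T -> \bar R) : (forall s t, 0 <= a s t)%E ->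
  (\esum_(s in [set: S]) \esum_(t in [set: T]) a s t =
   \esum_(t in [set: T]) \esum_(s in [set: S]) a s t)%E.
Proof.
move=> a0; rewrite !esum_esum//.
rewrite (reindex_esum ([set: T] `*`` (fun=> [set: S])) _
  (fun k : T * S => (k.2, k.1)))//.
split=> [[x y]//|[x y] [x' y'] _ _ /= [-> ->]//|[x y] _ /=].
by exists (y, x).
Qed.

Definition l1_dbl a : Prop :=
  (\esum_(s in [set: S]) \esum_(t in [set: T]) `|a s t|%:E < +oo)%E.

Lemma l1_dbl_row a s : l1_dbl a -> l1 (a s).
Proof.
move=> la; have : summable [set: S] (fun s => \esum_(t in [set: T]) `|a s t|%:E)%E.
  rewrite /summable; under eq_esum do rewrite gee0_abs ?esum_ge0//.
  exact: la.
move=> /summable_pinfty/(_ s I); rewrite gee0_abs ?esum_ge0//.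
Qed.

Lemma l1_dbl_rsum a : l1_dbl a -> l1 (fun s => rsum (a s)).
Proof.
move=> la; apply: le_lt_trans (la); apply: le_esum => s _.
have las := l1_dbl_row s la.
rewrite -rsum_pos_EFin//; last exact: l1_norm.
by rewrite -l1normE lee_fin norm_rsum.
Qed.

End double_sums.

Section exchange.
Context {R : realType}.

Lemma l1_dbl_swap (S T : choiceType) (a : S -> T -> R) :
  l1_dbl a -> l1_dbl (fun t s => a s t).
Proof. by rewrite /l1_dbl exchange_esum// => s t; rewrite lee_fin. Qed.

Lemma le_l1_dbl (S T : choiceType) (a b : S -> T -> R) :
  (forall s t, `|a s t| <= `|b s t|) -> l1_dbl b -> l1_dbl a.
Proof.
move=> ab; apply: le_lt_trans; apply: le_esum => s _; apply: le_esum => t _.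
by rewrite lee_fin.
Qed.

Let exchange_pos (S T : choiceType) (a : S -> T -> R) :
  (forall s t, 0 <= a s t) -> l1_dbl a ->
  rsum (fun s => rsum (a s)) = rsum (fun t => rsum (fun s => a s t)).
Proof.
have pos (S' T' : choiceType) (b : S' -> T' -> R) :
    (forall s t, 0 <= b s t) -> l1_dbl b -> rsum (fun s => rsum (b s)) =
    fine (\esum_(s in [set: S']) \esum_(t in [set: T']) (b s t)%:E)%E.
  move=> b0 lb; rewrite rsum_pos; last by move=> s; exact: rsum_ge0.
  congr fine; apply: eq_esum => s _.
  by rewrite rsum_pos_EFin//; exact: l1_dbl_row.
move=> a0 la; rewrite pos// (pos _ _ (fun t s => a s t))//; last exact: l1_dbl_swap.
by rewrite exchange_esum// => s t; rewrite lee_fin.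
Qed.

(** Fubini: both orders agree for nonnegative terms by reindexing a sum over
    pairs; absolute summability transfers this to the positive and the negative
    parts. *)
Lemma exchange_rsum (S T : choiceType) (a : S -> T -> R) : l1_dbl a ->
  rsum (fun s => rsum (a s)) = rsum (fun t => rsum (fun s => a s t)).
Proof.
move=> la.
pose ap s t := (`|a s t| + a s t) / 2.
pose an s t := (`|a s t| - a s t) / 2.
have ap0 s t : 0 <= ap s t.
  by rewrite /ap; have := ler_norm (- a s t); rewrite normrN; lra.
have an0 s t : 0 <= an s t by rewrite /an; have := ler_norm (a s t); lra.
have apn s t : ap s t <= `|a s t| /\ an s t <= `|a s t|.
  rewrite /ap /an; have := ler_norm (- a s t); have := ler_norm (a s t).
  by rewrite normrN; lra.
have lap : l1_dbl ap.
  by apply: le_l1_dbl la => s t; rewrite (ger0_norm (ap0 s t)); case: (apn s t).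
have lan : l1_dbl an.
  by apply: le_l1_dbl la => s t; rewrite (ger0_norm (an0 s t)); case: (apn s t).
have E s t : a s t = ap s t - an s t by rewrite /ap /an; lra.
transitivity (rsum (fun s => rsum (ap s)) - rsum (fun s => rsum (an s))).
  rewrite -rsumB; try exact: l1_dbl_rsum.
  apply: eq_rsum => s; rewrite -rsumB; try exact: l1_dbl_row.
  by apply: eq_rsum => t; exact: E.
rewrite (exchange_pos ap0 lap) (exchange_pos an0 lan) -rsumB;
  try exact/l1_dbl_rsum/l1_dbl_swap.
apply: eq_rsum => t; rewrite -rsumB.
- by apply: eq_rsum => s; rewrite -E.
- exact: (l1_dbl_row t (l1_dbl_swap lap)).
- exact: (l1_dbl_row t (l1_dbl_swap lan)).
Qed.
End exchange.

Section dominated.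
Context {R : realType} {S : choiceType}.

(** Dominated convergence along an arbitrary filter: finitely many indices carry
    almost all of p, and on them the convergence is uniform.  The filter is an
    ultrafilter on the integers in one use and a neighbourhood filter of X in
    others. *)
Lemma dominated_rsum (I : Type) (F : set_system I) (p : S -> R)
    (a : I -> S -> R) (c : R) : Filter F ->
  l1 p -> (forall i s, `|a i s| <= c) -> 0 <= c ->
  (forall s, a i s @[i --> F] --> (0 : R)) ->
  rsum (fun s => p s * a i s) @[i --> F] --> (0 : R).
Proof.
move=> FF lp ac c0 a0; apply/cvgr0Pnorm_le => e e0.
pose d := e / (2 * (l1norm p + 1)).
have np := l1norm_ge0 p.
have d0 : 0 < d by rewrite divr_gt0// mulr_gt0//; lra.
pose e' := e / (2 * (c + 1)).
have e'0 : 0 < e' by rewrite divr_gt0// mulr_gt0//; lra.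
have lnp := l1_norm lp.
have [A finA tA] := l1_tail (fun s => normr_ge0 (p s)) lnp e'0.
have lt : l1 (fun s => if s \in A then 0 else `|p s|).
  by apply: le_l1 lp => s; case: ifP => // _; rewrite ?normr0 ?normr_id.
have nA : F (\bigcap_(s in [set` fset_set A]) [set i | `|a i s| <= d]).
  by apply: filter_bigI => s _; have /cvgr0Pnorm_le := a0 s; apply.
near=> i.
have dA s : s \in A -> `|a i s| <= d.
  move=> sA; have : (\bigcap_(s in [set` fset_set A]) [set i | `|a i s| <= d]) i.
    by near: i.
  by apply; rewrite /= in_fset_set.
apply: le_trans (norm_rsum (l1M (ac i) lp)) _; rewrite l1normE.
apply: (@le_trans _ _ (rsum (fun s => d * `|p s| +
    c * (if s \in A then 0 else `|p s|)))).
  apply: le_rsum => [||s].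
  - exact/l1_norm/(l1M (ac i) lp).
  - by apply: l1D; exact: l1Z.
  - rewrite normrM; case: ifPn => sA.
      by rewrite mulr0 addr0 mulrC ler_wpM2r// dA.
    rewrite mulrC; apply: (@le_trans _ _ (c * `|p s|)); first by rewrite ler_wpM2r.
    by rewrite lerDr mulr_ge0// ltW.
rewrite rsumD; try exact: l1Z.
rewrite !rsumZ// -l1normE.
have h1 : d * l1norm p <= e / 2.
  have -> : e / 2 = d * (l1norm p + 1) by rewrite /d; field; lra.
  by rewrite ler_wpM2l ?(ltW d0)//; lra.
have h2 : c * rsum (fun s => if s \in A then 0 else `|p s|) <= e / 2.
  have -> : e / 2 = (c + 1) * e' by rewrite /e'; field; lra.
  apply: ler_pM => //; [|lra|exact: ltW].
  by apply: rsum_ge0 => s; case: ifP.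
lra.
Unshelve. all: by end_near. Qed.

Lemma cvg_pairing (I : Type) (F : set_system I) (p : S -> R)
    (f : I -> S -> R) (g : S -> R) (c : R) : Filter F ->
  l1 p -> (forall i s, `|f i s| <= c) -> (forall s, `|g s| <= c) -> 0 <= c ->
  (forall s, f i s @[i --> F] --> g s) ->
  rsum (fun s => p s * f i s) @[i --> F] --> rsum (fun s => p s * g s).
Proof.
move=> FF lp fc gc c0 fg; apply/subr_cvg0.
rewrite (_ : (fun i => _) = fun i => rsum (fun s => p s * (f i s - g s))).
  apply: (@dominated_rsum _ _ _ _ (c + c)) => //.
  - move=> i s; apply: le_trans (ler_normB _ _) _; exact: lerD.
  - by rewrite addr_ge0.
  - by move=> s; apply/subr_cvg0.
apply/funext => i; rewrite -rsumB; [|exact: l1M (fc i) lp|exact: l1M gc lp].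
by apply: eq_rsum => s; rewrite mulrBr.
Qed.

End dominated.

(** * Kernels acting on measures and on functions *)

Section kernel.
Context {R : realType} {S T : choiceType}.
Implicit Types (K : S -> T -> R) (mu : S -> R) (f : T -> R).

Definition bounded_kernel K (m : R) := forall s, l1 (K s) /\ l1norm (K s) <= m.

Definition push K mu t := rsum (fun s => mu s * K s t).
Definition pull K f s := rsum (fun t => K s t * f t).

Lemma l1_dbl_kernel K m mu : bounded_kernel K m -> l1 mu ->
  l1_dbl (fun s t => mu s * K s t).
Proof.
move=> Km lmu; rewrite /l1_dbl.
have : l1 (fun s => m * mu s) by exact: l1Z.
apply: le_lt_trans; apply: le_esum => s _.
under eq_esum do rewrite normrM EFinM.
rewrite esumZ// -(@rsum_pos_EFin _ _ (fun t => `|K s t|))//; last first.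
  by apply: l1_norm; case: (Km s).
rewrite -EFinM lee_fin -l1normE normrM mulrC ler_wpM2r//.
by case: (Km s) => _ /le_trans; apply; rewrite ler_norm.
Qed.

Lemma l1_push K m mu : bounded_kernel K m -> l1 mu -> l1 (push K mu).
Proof. by move=> Km lmu; exact/l1_dbl_rsum/l1_dbl_swap/(l1_dbl_kernel Km lmu). Qed.

Lemma pull_bounded K m f c : bounded_kernel K m -> 0 <= c ->
  (forall t, `|f t| <= c) -> forall s, `|pull K f s| <= c * m.
Proof.
move=> Km c0 fc s; case: (Km s) => lK Kle.
by apply: le_trans (norm_rsumM lK fc) _; rewrite ler_wpM2l.
Qed.

Lemma push_pull K m mu f c : bounded_kernel K m -> l1 mu ->
  (forall t, `|f t| <= c) ->
  rsum (fun t => push K mu t * f t) = rsum (fun s => mu s * pull K f s).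
Proof.
move=> Km lmu fc.
have l2 := l1_dbl_kernel Km lmu.
have l3 : l1_dbl (fun s t => mu s * K s t * f t).
  have : l1_dbl (fun s t => (c * mu s) * K s t).
    by apply: (l1_dbl_kernel Km); exact: l1Z.
  apply: le_l1_dbl => s t; rewrite [leLHS]normrM -mulrA [leRHS]normrM mulrC.
  by rewrite ler_wpM2r// (le_trans (fc t)) ?ler_norm.
transitivity (rsum (fun t => rsum (fun s => mu s * K s t * f t))).
  apply: eq_rsum => t; rewrite /push -rsumZr//.
  exact: (l1_dbl_row t (l1_dbl_swap l2)).
rewrite -(exchange_rsum l3); apply: eq_rsum => s; rewrite /pull -rsumZ.
  by apply: eq_rsum => t; rewrite mulrA.
by apply: (@l1M _ _ f c) => //; case: (Km s).
Qed.

(** Keeping the norms of the rows inside the sum lets dominated convergence apply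
    when the rows tend to 0 one by one; see [l1_continuous_push]. *)
Lemma l1norm_push_weighted K m mu : bounded_kernel K m -> l1 mu ->
  l1norm (push K mu) <= rsum (fun s => `|mu s| * l1norm (K s)).
Proof.
move=> Km lmu; have l2 := l1_dbl_kernel Km lmu.
have l3 : l1_dbl (fun s t => `|mu s * K s t|).
  by apply: le_l1_dbl l2 => s t; rewrite normr_id.
rewrite l1normE (_ : rsum (fun s => `|mu s| * _) =
    rsum (fun s => rsum (fun t => `|mu s * K s t|))); last first.
  apply: eq_rsum => s; rewrite l1normE -rsumZ.
    by apply: eq_rsum => t; rewrite normrM.
  by apply: l1_norm; case: (Km s).
rewrite (exchange_rsum l3); apply: le_rsum.
- exact/l1_norm/l1_push/lmu/Km.
- exact: l1_dbl_rsum (l1_dbl_swap l3).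
- move=> t; rewrite -l1normE; apply: norm_rsum.
  exact: (l1_dbl_row t (l1_dbl_swap l2)).
Qed.

Lemma l1norm_push K m mu : bounded_kernel K m -> l1 mu ->
  l1norm (push K mu) <= m * l1norm mu.
Proof.
move=> Km lmu; apply: le_trans (l1norm_push_weighted Km lmu) _.
have h s : `| l1norm (K s) | <= m by rewrite ger0_norm ?l1norm_ge0//; case: (Km s).
rewrite l1normE -rsumZ; last exact: l1_norm.
apply: le_rsum.
- exact/(l1M h)/l1_norm.
- exact/l1Z/l1_norm.
- by move=> s; rewrite mulrC ler_wpM2r//; case: (Km s).
Qed.

Lemma push_ge0 K mu : (forall s t, 0 <= K s t) -> (forall s, 0 <= mu s) ->
  forall t, 0 <= push K mu t.
Proof. by move=> K0 mu0 t; apply: rsum_ge0 => s; rewrite mulr_ge0. Qed.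

Lemma pushD K m mu nu : bounded_kernel K m -> l1 mu -> l1 nu ->
  push K (fun s => mu s + nu s) = (fun t => push K mu t + push K nu t).
Proof.
move=> Km lmu lnu; apply/funext => t; rewrite /push -rsumD.
- by apply: eq_rsum => s; rewrite mulrDl.
- exact: (l1_dbl_row t (l1_dbl_swap (l1_dbl_kernel Km lmu))).
- exact: (l1_dbl_row t (l1_dbl_swap (l1_dbl_kernel Km lnu))).
Qed.

Lemma pushZ K m mu c : bounded_kernel K m -> l1 mu ->
  push K (fun s => c * mu s) = (fun t => c * push K mu t).
Proof.
move=> Km lmu; apply/funext => t; rewrite /push -rsumZ.
- by apply: eq_rsum => s; rewrite mulrA.
- exact: (l1_dbl_row t (l1_dbl_swap (l1_dbl_kernel Km lmu))).
Qed.

Lemma pushB K m mu nu : bounded_kernel K m -> l1 mu -> l1 nu ->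
  push K (mu \- nu) = push K mu \- push K nu.
Proof.
move=> Km lmu lnu; rewrite (_ : mu \- nu = fun s => mu s + (-1) * nu s); last first.
  by apply/funext => s /=; rewrite mulN1r.
rewrite (pushD Km)// ?(pushZ _ Km)//; last exact: l1Z.
by apply/funext => s /=; rewrite mulN1r.
Qed.

Lemma push_delta K s : push K (delta s) = K s.
Proof. by apply/funext => t; rewrite /push rsum_delta. Qed.

Lemma mass_kernel b K : (forall s, has_mass b (K s)) -> bounded_kernel K b.
Proof. by move=> Kb s; split; [case: (Kb s)|rewrite (has_mass_l1norm (Kb s))]. Qed.

Lemma prob_kernel K : (forall s, is_prob (K s)) -> bounded_kernel K 1.
Proof. by move=> Kp; apply: mass_kernel => s; exact/prob_mass. Qed.

Lemma push_mass b c K mu : (forall s, has_mass b (K s)) -> has_mass c mu ->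
  has_mass (c * b) (push K mu).
Proof.
move=> Kb [mu0 lmu muc]; have Km := mass_kernel Kb; split.
- by apply: push_ge0 => // s t; case: (Kb s).
- exact: l1_push Km lmu.
- have one (t : T) : `|1 : R| <= 1 by rewrite normr1.
  have := push_pull Km lmu one.
  under eq_rsum do rewrite mulr1.
  move=> ->; rewrite -muc -rsumZr//; apply: eq_rsum => s; rewrite /pull.
  under eq_rsum do rewrite mulr1.
  by case: (Kb s) => _ _ ->.
Qed.

Lemma push_prob K mu : (forall s, is_prob (K s)) -> is_prob mu ->
  is_prob (push K mu).
Proof.
move=> Kp /prob_mass mup; apply/prob_mass; rewrite -[1]mulr1.
by apply: push_mass => // s; exact/prob_mass.
Qed.

End kernel.

(** * Dyadic Cesaro averages and bounded harmonic functions *)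

Section dyadic_average.
Context {R : realType} {S : Type}.
Implicit Types (T P : (S -> R) -> S -> R) (mu f : S -> R).

(** For linear T, the average of T^k mu over k < 2^n, obtained by doubling.  This
    form shows at once that norms decrease with n when T is a contraction. *)
Fixpoint dyadic_avg T n mu : S -> R :=
  if n is n'.+1 then
    fun s => 2^-1 * (dyadic_avg T n' mu s + iter (2 ^ n') T (dyadic_avg T n' mu) s)
  else mu.

Fixpoint dyadic_avg_dual P n f : S -> R :=
  if n is n'.+1 then
    dyadic_avg_dual P n' (fun s => 2^-1 * (f s + iter (2 ^ n') P f s))
  else f.

Lemma iter_stable (Q : (S -> R) -> Prop) T k mu :
  (forall nu, Q nu -> Q (T nu)) -> Q mu -> Q (iter k T mu).
Proof. by move=> QT Qmu; elim: k => //= k; exact: QT. Qed.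

Lemma dyadic_avg_stable (Q : (S -> R) -> Prop) T n mu :
  (forall nu, Q nu -> Q (T nu)) ->
  (forall nu nu', Q nu -> Q nu' -> Q (fun s => 2^-1 * (nu s + nu' s))) ->
  Q mu -> Q (dyadic_avg T n mu).
Proof.
move=> QT Qavg Qmu; elim: n => //= n IH.
by apply: Qavg => //; exact: iter_stable.
Qed.

End dyadic_average.

Lemma ultra_fmap (I J : Type) (h : I -> J) (F : set_system I) :
  UltraFilter F -> UltraFilter (h @ F).
Proof.
move=> UF; split; first exact: fmap_proper_filter.
move=> G PG FG; apply/seteqP; split => // A GA.
have [//|FnA] := in_ultra_setVsetC (h @^-1` A) UF.
have : G (A `&` ~` A) by apply: filterI => //; apply: FG.
by rewrite setICr => /filter_ex[].
Qed.

Section markov_chain.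
Context {R : realType} {S : choiceType}.
Variable K : S -> S -> R.
Hypothesis Kprob : forall s, is_prob (K s).
Implicit Types (mu nu f g : S -> R).

Let K1 : bounded_kernel K 1 := prob_kernel Kprob.

Let T := push K.
Let P := pull K.

Lemma l1_dyadic_avg n mu : l1 mu -> l1 (dyadic_avg T n mu).
Proof.
apply: dyadic_avg_stable => [nu|nu nu' ln ln']; first exact: l1_push K1.
by apply: l1Z; exact: l1D.
Qed.

Lemma dyadic_avgB n mu nu : l1 mu -> l1 nu ->
  dyadic_avg T n (mu \- nu) = dyadic_avg T n mu \- dyadic_avg T n nu.
Proof.
move=> lmu lnu.
have itB k p q : l1 p -> l1 q -> iter k T (p \- q) = iter k T p \- iter k T q.
  move=> lp lq; elim: k => //= k ->; rewrite /T (pushB K1)//.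
  - by apply: iter_stable => // r; exact: l1_push K1.
  - by apply: iter_stable => // r; exact: l1_push K1.
elim: n => //= n ->; rewrite itB; [|exact: l1_dyadic_avg..].
by apply/funext => s /=; ring.
Qed.

Lemma l1norm_iter_push k mu : l1 mu -> l1norm (iter k T mu) <= l1norm mu.
Proof.
move=> lmu; elim: k => //= k IH; apply: le_trans IH.
have := @l1norm_push _ _ _ K 1 (iter k T mu) K1.
rewrite mul1r; apply.
by apply: iter_stable => // nu; exact: l1_push K1.
Qed.

(** A step of the doubling averages A_n mu with an image of A_n mu under a
    contraction. *)
Lemma l1norm_dyadic_avgS n mu : l1 mu ->
  l1norm (dyadic_avg T n.+1 mu) <= l1norm (dyadic_avg T n mu).
Proof.
move=> lmu /=; have ln := l1_dyadic_avg n lmu.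
have li : l1 (iter (2 ^ n) T (dyadic_avg T n mu)).
  by apply: iter_stable => // nu; exact: l1_push K1.
rewrite l1normZ ?ger0_norm ?invr_ge0//; last exact: l1D.
rewrite mulrC ler_pdivrMr//.
apply: le_trans (l1normD ln li) _.
by have := l1norm_iter_push (2 ^ n) ln; lra.
Qed.

Lemma l1norm_dyadic_avg_homo m n mu : l1 mu -> (m <= n)%N ->
  l1norm (dyadic_avg T n mu) <= l1norm (dyadic_avg T m mu).
Proof.
move=> lmu /subnK <-; elim: (n - m)%N => // k IH.
by rewrite addSn; apply: le_trans IH; exact: l1norm_dyadic_avgS.
Qed.

Let bdd (c : R) f := forall s, `|f s| <= c.

Lemma bounded_pull c f : 0 <= c -> (forall s, `|f s| <= c) ->
  forall s, `|P f s| <= c.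
Proof. by move=> c0 fc s; have := pull_bounded K1 c0 fc s; rewrite mulr1. Qed.

Let bdd_iter c k f : 0 <= c -> bdd c f -> bdd c (iter k P f).
Proof.
move=> c0; apply: (@iter_stable _ _ (bdd c)) => nu; exact: bounded_pull.
Qed.

Let bdd_avg c f g : bdd c f -> bdd c g -> bdd c (fun s => 2^-1 * (f s + g s)).
Proof.
move=> fc gc s; rewrite normrM ger0_norm ?invr_ge0//.
rewrite mulrC ler_pdivrMr//; apply: le_trans (ler_normD _ _) _.
by have := fc s; have := gc s; lra.
Qed.

Let pull_avg c f g : bdd c f -> bdd c g ->
  P (fun s => 2^-1 * (f s + g s)) = fun s => 2^-1 * (P f s + P g s).
Proof.
move=> fc gc; apply/funext => s; rewrite /P /pull; case: (K1 s) => lK _.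
have lf := l1M fc lK; have lg := l1M gc lK.
rewrite -rsumD// -rsumZ; last exact: l1D.
by apply: eq_rsum => t; ring.
Qed.

Let iter_avg c k f g : 0 <= c -> bdd c f -> bdd c g ->
  iter k P (fun s => 2^-1 * (f s + g s)) =
  fun s => 2^-1 * (iter k P f s + iter k P g s).
Proof.
move=> c0 fc gc; elim: k => //= k ->.
by apply: (@pull_avg c); exact: bdd_iter.
Qed.

Lemma dyadic_avg_dual_bounded c n f : 0 <= c -> (forall s, `|f s| <= c) ->
  forall s, `|dyadic_avg_dual P n f s| <= c.
Proof.
move=> c0; elim: n f => //= n IH f fc; apply: IH.
by apply: bdd_avg => //; exact: bdd_iter.
Qed.

Let iter_dual c k mu f : 0 <= c -> l1 mu -> bdd c f ->
  rsum (fun s => iter k T mu s * f s) = rsum (fun s => mu s * iter k P f s).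
Proof.
move=> c0 lmu; elim: k f => //= k IH f fc.
rewrite (push_pull K1 _ fc) ?IH//.
- by rewrite -iterSr.
- exact: bounded_pull.
- by apply: iter_stable => // nu; exact: l1_push K1.
Qed.

Lemma dyadic_avg_duality c n mu f : 0 <= c -> l1 mu -> (forall s, `|f s| <= c) ->
  rsum (fun s => dyadic_avg T n mu s * f s) =
  rsum (fun s => mu s * dyadic_avg_dual P n f s).
Proof.
move=> c0 lmu; elim: n f => //= n IH f fc.
have ln := l1_dyadic_avg n lmu.
have li : l1 (iter (2 ^ n) T (dyadic_avg T n mu)).
  by apply: iter_stable => // nu; exact: l1_push K1.
have bi := bdd_iter (2 ^ n) c0 fc.
rewrite -IH; last exact: bdd_avg.
transitivity (2^-1 * (rsum (fun s => dyadic_avg T n mu s * f s) +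
    rsum (fun s => iter (2 ^ n) T (dyadic_avg T n mu) s * f s))).
  rewrite -rsumD; [|exact: l1M fc ln|exact: l1M fc li].
  rewrite -rsumZ; last by apply: l1D; [exact: l1M fc ln|exact: l1M fc li].
  by apply: eq_rsum => s; ring.
rewrite (iter_dual _ c0 ln fc) -rsumD; [|exact: l1M fc ln|exact: l1M bi ln].
rewrite -rsumZ; last by apply: l1D; [exact: l1M fc ln|exact: l1M bi ln].
by apply: eq_rsum => s; ring.
Qed.

(** The average of P^k f over k < 2^n is almost harmonic: applying P shifts the
    range of summation by one and only the two end terms survive. *)
Lemma dyadic_avg_telescope c n f : 0 <= c -> (forall s, `|f s| <= c) -> forall s,
  P (dyadic_avg_dual P n f) s - dyadic_avg_dual P n f s =
  2^-1 ^+ n * (iter (2 ^ n) P f s - f s).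
Proof.
move=> c0; elim: n f => [|n IH] f fc s; first by rewrite expr0 mul1r.
rewrite /= IH; last by apply: bdd_avg => //; exact: bdd_iter.
rewrite (iter_avg _ c0 fc (bdd_iter _ c0 fc)) -iterD addnn -mul2n -expnS exprS.
by ring.
Qed.

(** The easy half of the zero-two law.  If the norms of A_n mu stayed above e, take
    f_n to be the sign of A_n mu, so that the dual averages g_n of f_n satisfy
    <mu, g_n> >= e.  The g_n are bounded by 1, hence converge pointwise along an
    ultrafilter; by [dyadic_avg_telescope] the limit is harmonic, so constant, so
    orthogonal to mu: a contradiction. *)
Lemma dyadic_avg_cvg0 mu :
  (forall g c, (forall s, `|g s| <= c) -> g =1 P g -> exists d, forall s, g s = d) ->
  l1 mu -> rsum mu = 0 ->
  forall e, 0 < e -> exists n, l1norm (dyadic_avg T n mu) < e.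
Proof.
move=> liou lmu mu0 e e0; apply: contrapT => /forallNP noN.
have leN n : e <= l1norm (dyadic_avg T n mu) by rewrite leNgt; apply/negP.
pose f n s : R := Num.sg (dyadic_avg T n mu s).
have f1 n s : `|f n s| <= 1 by rewrite normr_sg; case: (_ == _).
pose g n := dyadic_avg_dual P n (f n).
have g1 n s : `|g n s| <= 1 by apply: dyadic_avg_dual_bounded.
have gmu n : e <= rsum (fun s => mu s * g n s).
  rewrite -(dyadic_avg_duality _ ler01)// (le_trans (leN n))// l1normE.
  rewrite le_eqVlt; apply/orP; left; apply/eqP; apply: eq_rsum => s.
  by rewrite normrEsg mulrC.
have [U [UU ooU]] := ultraFilterLemma eventually_filter.
have glim s : exists l : R, `|l| <= 1 /\ g n s @[n --> U] --> l.
  have := @segment_compact R (-1) 1; rewrite compact_ultra.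
  move=> /(_ _ (ultra_fmap (fun n => g n s) UU)) [].
    by apply: (@filterE _ U) => n /=; rewrite in_itv/= -ler_norml; exact: g1.
  move=> l [/= +] lim; rewrite in_itv/= -ler_norml => l_le1.
  by exists l.
have /choice[h hP] := glim.
have h1 s : `|h s| <= 1 by case: (hP s).
have hlim s : g n s @[n --> U] --> h s by case: (hP s).
have Ph : h =1 P h.
  move=> s.
  have c1 : P (g n) s @[n --> U] --> P h s.
    by apply: (@cvg_pairing _ _ _ _ (K s) g h 1) => //; case: (K1 s).
  have c2 : (P (g n) s - g n s) @[n --> U] --> (0 : R).
    apply: cvg_trans (cvg_app _ ooU) _; apply/cvgr0Pnorm_le => d d0.
    have half : `|2^-1 : R| < 1 by rewrite ger0_norm ?invr_ge0// invf_lt1// ltr1n.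
    have d2 : 0 < d / 2 by rewrite divr_gt0.
    have /cvgr0Pnorm_le/(_ (d / 2) d2) := cvg_expr half.
    apply: filterS => n hn; rewrite (dyadic_avg_telescope _ ler01)// normrM.
    have := ler_normB (iter (2 ^ n) P (f n) s) (f n s).
    have := bdd_iter (2 ^ n) ler01 (f1 n) s; have := f1 n s => h3 h4 h5.
    apply: (@le_trans _ _ (d / 2 * 2)); last by lra.
    by apply: ler_pM => //; lra.
  have c3 : P (g n) s @[n --> U] --> h s.
    rewrite -[h s]add0r (_ : (fun n => _) = fun n => (P (g n) s - g n s) + g n s).
      exact: cvgD c2 (hlim s).
    by apply/funext => n; rewrite subrK.
  exact: (@cvg_unique _ _ _ _ _ _ c3 c1).
have [d hd] := liou h 1 h1 Ph.
have : rsum (fun s => mu s * g n s) @[n --> U] --> rsum (fun s => mu s * h s).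
  exact: (@cvg_pairing _ _ _ _ mu g h 1).
have -> : rsum (fun s => mu s * h s) = 0.
  by under eq_rsum do rewrite hd; rewrite rsumZr// mu0 mul0r.
move=> /cvgr0Pnorm_lt /(_ e e0) /filter_ex[n].
have := gmu n; have := ler_norm (rsum (fun s => mu s * g n s)); lra.
Qed.

End markov_chain.

(** * Continuous families of summable functions *)

Section l1_continuity.
Context {R : realType} {X : topologicalType}.

Lemma l1_continuousP (S : choiceType) (p : X -> S -> R) :
  l1_continuous p <->
  forall x0 e, 0 < e -> \forall x \near x0, l1norm (p x \- p x0) <= e.
Proof.
split=> [pc x0 e e0|pc x0].
  have /cvgr0Pnorm_le/(_ e e0) := pc x0.
  by apply: filterS => x; rewrite ger0_norm ?l1norm_ge0.
apply/cvgr0Pnorm_le => e e0; have := pc x0 e e0.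
by apply: filterS => x; rewrite ger0_norm ?l1norm_ge0.
Qed.

Lemma l1_continuous_cst (S : choiceType) (mu : S -> R) :
  l1_continuous (fun _ : X => mu).
Proof.
apply/l1_continuousP => x0 e e0; apply: filterE => x.
rewrite (_ : mu \- mu = fun _ => 0) ?l1normE; last first.
  by apply/funext => s /=; rewrite subrr.
by under eq_rsum do rewrite normr0; rewrite rsum0 ltW.
Qed.

Lemma l1_continuousD (S : choiceType) (p q : X -> S -> R) :
  (forall x, l1 (p x)) -> (forall x, l1 (q x)) ->
  l1_continuous p -> l1_continuous q ->
  l1_continuous (fun x s => p x s + q x s).
Proof.
move=> lp lq /l1_continuousP pc /l1_continuousP qc; apply/l1_continuousP => x0 e e0.
have e2 : 0 < e / 2 by rewrite divr_gt0.
near=> x.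
have h1 : l1norm (p x \- p x0) <= e / 2 by near: x; exact: pc.
have h2 : l1norm (q x \- q x0) <= e / 2 by near: x; exact: qc.
rewrite (_ : _ \- _ = (p x \- p x0) \+ (q x \- q x0)); last first.
  by apply/funext => s /=; ring.
apply: le_trans (l1normD _ _) _; [exact: l1B|exact: l1B|lra].
Unshelve. all: by end_near. Qed.

Lemma l1_continuousZ (S : choiceType) (c : R) (p : X -> S -> R) :
  (forall x, l1 (p x)) -> l1_continuous p -> l1_continuous (fun x s => c * p x s).
Proof.
move=> lp pc x0.
rewrite (_ : (fun x => _) = fun x => `|c| * l1norm (p x \- p x0)).
  rewrite -[X in _ --> X](mulr0 `|c|).
  by apply: cvgM; [exact: cvg_cst|exact: pc].
apply/funext => x; rewrite -l1normZ; last exact: l1B.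
by congr l1norm; apply/funext => s /=; rewrite mulrBr.
Qed.

Lemma l1_continuousB (S : choiceType) (p q : X -> S -> R) :
  (forall x, l1 (p x)) -> (forall x, l1 (q x)) ->
  l1_continuous p -> l1_continuous q ->
  l1_continuous (fun x => p x \- q x).
Proof.
move=> lp lq pc qc.
rewrite (_ : (fun x => _) = fun x s => p x s + (-1) * q x s); last first.
  by apply/funext => x; apply/funext => s /=; rewrite mulN1r.
apply: l1_continuousD => //; first by move=> x; exact: l1Z.
exact: l1_continuousZ.
Qed.

(** Varying the measure costs at most m times its variation; varying the kernel
    costs a weighted sum of the variations of the rows, each of which tends to 0
    while staying below 2 m. *)
Lemma l1_continuous_push (S T : choiceType) (m : R) (K : X -> S -> T -> R)
    (mu : X -> S -> R) :
  (forall x, bounded_kernel (K x) m) -> (forall s, l1_continuous (fun x => K x s)) ->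
  (forall x, l1 (mu x)) -> l1_continuous mu ->
  l1_continuous (fun x => push (K x) (mu x)).
Proof.
move=> Km Kc lmu muc x0.
pose b x := m * l1norm (mu x \- mu x0) +
  rsum (fun s => `|mu x0 s| * l1norm (K x s \- K x0 s)).
apply: (@squeeze_cvgr _ _ _ _ (fun=> 0) b); last 2 first.
- exact: cvg_cst.
- rewrite -[X in _ --> X]addr0; apply: cvgD.
    rewrite -[X in _ --> X](mulr0 m).
    by apply: cvgM; [exact: cvg_cst|exact: muc].
  apply: (@dominated_rsum _ _ _ _ _ _ `|m + m|) => //.
  + exact: l1_norm.
  + move=> x s; rewrite ger0_norm ?l1norm_ge0//.
    have [lx hx] := Km x s; have [lx0 hx0] := Km x0 s.
    apply: le_trans (l1normB lx lx0) _.
    by apply: le_trans (lerD hx hx0) _; exact: ler_norm.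
  + by move=> s; exact: Kc.
- apply: filterE => x; rewrite l1norm_ge0/= /b.
  have KB : bounded_kernel (fun s => K x s \- K x0 s) (m + m).
    move=> s; have [lx hx] := Km x s; have [lx0 hx0] := Km x0 s.
    by split; [exact: l1B|apply: le_trans (l1normB lx lx0) _; exact: lerD].
  have KE t : push (fun s => K x s \- K x0 s) (mu x0) t =
      push (K x) (mu x0) t - push (K x0) (mu x0) t.
    rewrite /push -rsumB.
    - by apply: eq_rsum => s; rewrite mulrBr.
    - exact: (l1_dbl_row t (l1_dbl_swap (l1_dbl_kernel (Km x) (lmu x0)))).
    - exact: (l1_dbl_row t (l1_dbl_swap (l1_dbl_kernel (Km x0) (lmu x0)))).
  have -> : push (K x) (mu x) \- push (K x0) (mu x0) =
      push (K x) (mu x \- mu x0) \+ push (fun s => K x s \- K x0 s) (mu x0).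
    by rewrite (pushB (Km x))//; apply/funext => t /=; rewrite KE; ring.
  apply: le_trans (l1normD _ _) _.
  + by apply: (l1_push (Km x)); exact: l1B.
  + exact: (l1_push KB).
  + apply: lerD; first by apply: (l1norm_push (Km x)); exact: l1B.
    exact: (l1norm_push_weighted KB).
Qed.

Lemma l1_continuous_norm (S : choiceType) (p : X -> S -> R) x0 (e : R) :
  (forall x, l1 (p x)) -> l1_continuous p -> l1norm (p x0) < e ->
  \forall x \near x0, l1norm (p x) < e.
Proof.
move=> lp /l1_continuousP pc h.
have d0 : 0 < (e - l1norm (p x0)) / 2 by rewrite divr_gt0// subr_gt0.
have := pc x0 _ d0; apply: filterS => x hx.
rewrite (_ : p x = (p x \- p x0) \+ p x0); last first.
  by apply/funext => s /=; rewrite subrK.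
apply: le_lt_trans (l1normD _ _) _; [exact: l1B|by []|lra].
Qed.

End l1_continuity.

(** * Translates and the Markov chain on a fibre *)

Section translation.
Context {R : realType} {S : monoidType}.
Implicit Types (p q : S -> R) (f : S -> R).

(** [ltranslate] written as the action of a kernel, so that the calculus of [push]
    and [pull] applies, also to signed measures. *)
Definition translate (s : S) (p : S -> R) : S -> R :=
  push (fun t => delta (s * t)%g) p.

Lemma delta_bounded (T : choiceType) (h : S -> T) :
  bounded_kernel (fun t => delta (h t) : T -> R) 1.
Proof.
move=> t; split; first exact: l1_delta.
by rewrite prob_l1norm//; exact: delta_prob.
Qed.

Lemma ltranslateE s p : (forall t, 0 <= p t) -> ltranslate s p = translate s p.
Proof.
move=> p0; apply/funext => u; rewrite /ltranslate /translate /push rsum_pos.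
  congr fine; rewrite esum_mkcond; apply: eq_esum => t _.
  rewrite /delta; case: eqVneq => [->|ust].
    by rewrite mem_set// mulr1.
  by rewrite memNset ?mulr0// => /= E; move: ust; rewrite E eqxx.
by move=> t; rewrite mulr_ge0// /delta ler0n.
Qed.

Lemma l1_translate s p : l1 p -> l1 (translate s p).
Proof. exact/l1_push/delta_bounded. Qed.

Lemma translate_prob s p : is_prob p -> is_prob (translate s p).
Proof. by apply: push_prob => t; exact: delta_prob. Qed.

Lemma l1norm_translate s p : l1 p -> l1norm (translate s p) <= l1norm p.
Proof.
move=> lp; rewrite -[leRHS]mul1r; apply: l1norm_push => //; exact: delta_bounded.
Qed.

Lemma translateB s p q : l1 p -> l1 q ->
  translate s (p \- q) = translate s p \- translate s q.
Proof. by move=> lp lq; apply: pushB lp lq; exact: delta_bounded. Qed.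

Lemma translate_avg c s p q : l1 p -> l1 q ->
  translate s (fun t => c * (p t + q t)) =
  fun t => c * (translate s p t + translate s q t).
Proof.
move=> lp lq; rewrite /translate (pushZ _ (delta_bounded _)); last exact: l1D.
by rewrite (pushD (delta_bounded _)).
Qed.

Lemma translate_delta s t : translate s (delta t) = delta (s * t)%g.
Proof. exact: push_delta. Qed.

Lemma translate_pairing s p f c : l1 p -> (forall t, `|f t| <= c) ->
  rsum (fun u => translate s p u * f u) = rsum (fun t => p t * f (s * t)%g).
Proof.
move=> lp fc; rewrite (push_pull (delta_bounded _) lp fc).
by apply: eq_rsum => t; rewrite /pull rsum_delta.
Qed.

Lemma pairing_ext (T : choiceType) (p q : T -> R) :
  (forall f : T -> R, (forall t, `|f t| <= 1) ->
    rsum (fun t => p t * f t) = rsum (fun t => q t * f t)) -> p = q.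
Proof.
move=> pq; apply/funext => t; have := pq (delta t).
have E r : rsum (fun u : T => r u * delta t u) = r t :> R.
  by rewrite -[RHS](rsum_delta t r); apply: eq_rsum => u; rewrite mulrC.
rewrite !E; apply => u; rewrite /delta; case: (_ == _); rewrite ?normr1 ?normr0//.
Qed.

End translation.

Section fibre.
Context {R : realType} {X : topologicalType} {S : monoidType}.
Variable act : X -> S -> X.
Hypothesis actP : is_right_action act.
Hypothesis act_cont : forall s, continuous (fun x => act x s).
Implicit Types (p : X -> S -> R) (f mu : S -> R).

(** The arrow (x, u) has source x.u, so the step taken from u has law p_(x.u). *)
Definition fibre_kernel p x : S -> S -> R := fun u => translate u (p (act x u)).

Lemma fibre_kernel_prob p x : (forall y, is_prob (p y)) ->
  forall u, is_prob (fibre_kernel p x u).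
Proof. by move=> pp u; exact: translate_prob. Qed.

Lemma fibre_kernel_bounded p m x : (forall y, l1 (p y)) ->
  (forall y, l1norm (p y) <= m) -> bounded_kernel (fibre_kernel p x) m.
Proof.
move=> lp pm u; split; first exact: l1_translate.
exact: le_trans (l1norm_translate _ (lp _)) _.
Qed.

Lemma pull_fibre p x f c u : (forall y, l1 (p y)) -> (forall t, `|f t| <= c) ->
  pull (fibre_kernel p x) f u = rsum (fun t => p (act x u) t * f (u * t)%g).
Proof. by move=> lp fc; rewrite /pull (translate_pairing _ _ fc). Qed.

(** Left translation by s embeds the chain on the fibre over x.s into the chain on
    the fibre over x, because x.(s u) = (x.s).u. *)
Lemma push_fibre_translate p m x s mu : (forall y, l1 (p y)) ->
  (forall y, l1norm (p y) <= m) -> l1 mu ->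
  push (fibre_kernel p x) (translate s mu) =
  translate s (push (fibre_kernel p (act x s)) mu).
Proof.
move=> lp pm lmu; have Kb y := fibre_kernel_bounded y lp pm.
apply: pairing_ext => f f1.
have m0 : 0 <= m by apply: le_trans (pm x); exact: l1norm_ge0.
rewrite (push_pull (Kb x) (l1_translate _ lmu) f1).
rewrite (translate_pairing _ lmu (pull_bounded (Kb x) ler01 f1)).
rewrite (translate_pairing _ (l1_push (Kb _) lmu) f1).
have f1s t : `|f (s * t)%g| <= 1 by [].
rewrite (push_pull (Kb _) lmu f1s); apply: eq_rsum => u; congr (_ * _).
rewrite (pull_fibre _ _ lp f1) (pull_fibre _ _ lp f1s) -(proj2 actP).
by apply: eq_rsum => t; rewrite mulgA.
Qed.

Lemma l1_continuous_translate s p : (forall y, l1 (p y)) -> l1_continuous p ->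
  l1_continuous (fun x => translate s (p (act x s))).
Proof.
move=> lp /l1_continuousP pc; apply/l1_continuousP => x0 e e0.
have : \forall x \near x0, l1norm (p (act x s) \- p (act x0 s)) <= e.
  exact: @act_cont s x0 _ (pc (act x0 s) e e0).
apply: filterS => x; rewrite -translateB//; apply: le_trans.
by apply: l1norm_translate; exact: l1B.
Qed.

Lemma l1_continuous_fibre p m (mu : X -> S -> R) : (forall y, l1 (p y)) ->
  (forall y, l1norm (p y) <= m) -> l1_continuous p ->
  (forall x, l1 (mu x)) -> l1_continuous mu ->
  l1_continuous (fun x => push (fibre_kernel p x) (mu x)).
Proof.
move=> lp pm pc lmu muc; apply: (@l1_continuous_push _ _ _ _ m) => //.
  by move=> x; exact: fibre_kernel_bounded.
by move=> s; exact: l1_continuous_translate.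
Qed.

Lemma norm_ReIm_le (z : R[i]) (M : R) : `|z| <= M%:C%C ->
  `|complex.Re z| <= M /\ `|complex.Im z| <= M.
Proof.
rewrite normc_def lecR => zM; split; apply: le_trans zM.
  by rewrite -sqrtr_sqr ler_wsqrtr// lerDl sqr_ge0.
by rewrite -sqrtr_sqr ler_wsqrtr// lerDr sqr_ge0.
Qed.

Lemma harmonicP p x (f : S -> R[i]) M : (forall y, l1 (p y)) ->
  (forall s, `|f s| <= M%:C%C) ->
  Defs.harmonic act p x f <->
  (forall r, complex.Re (f r) =
     pull (fibre_kernel p x) (fun s => complex.Re (f s)) r) /\
  (forall r, complex.Im (f r) =
     pull (fibre_kernel p x) (fun s => complex.Im (f s)) r).
Proof.
move=> lp fM.
have reM s : `|complex.Re (f s)| <= M by case: (norm_ReIm_le (fM s)).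
have imM s : `|complex.Im (f s)| <= M by case: (norm_ReIm_le (fM s)).
rewrite /Defs.harmonic /csum; split=> [h|[hr hi] r].
  split=> r; rewrite (pull_fibre _ _ lp reM) || rewrite (pull_fibre _ _ lp imM).
    rewrite {1}h /=; apply: eq_rsum => s; move: (f (r * s)%g) => [a b] /=; ring.
  rewrite {1}h /=; apply: eq_rsum => s; move: (f (r * s)%g) => [a b] /=; ring.
apply/eqP; rewrite eq_complex /= hr hi.
rewrite (pull_fibre _ _ lp reM) (pull_fibre _ _ lp imM).
apply/andP; split; apply/eqP; apply: eq_rsum => s;
  move: (f (r * s)%g) => [a b] /=; ring.
Qed.

End fibre.

(** * From Liouville to uniform Reiter *)

Lemma family_compact_cvg0P (R : realType) (X : topologicalType) (D : nat -> X -> R) :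
  {family compact, D @ \oo --> (fun _ : X => 0 : R)} <->
  (forall A, compact A -> forall e, 0 < e ->
    \forall n \near \oo, forall x, A x -> `|D n x| < e).
Proof.
split=> [/fam_cvgP DA A cA e e0|DA].
  have := DA A cA => /(_ [set h | forall x, A x -> `|h x| < e]); apply.
  apply/uniform_nbhs; exists [set xy : R * R | ball xy.1 e xy.2]; split.
    by rewrite -entourage_ballE; exists e.
  by move=> h /= hA x /hA; rewrite /ball/= sub0r normrN.
apply/fam_cvgP => A cA P /uniform_nbhs[E [entE EP]].
move: entE; rewrite -entourage_ballE => -[e /= e0 eE].
have := DA A cA e e0; apply: filterS => n hn; apply: EP => y Ay.
by apply: eE; rewrite /= /ball/= sub0r normrN; exact: hn.
Qed.

Section liouville_reiter.
Context {R : realType} {X : topologicalType} {S : monoidType}.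
Variable act : X -> S -> X.
Hypothesis actP : is_right_action act.
Hypothesis act_cont : forall s, continuous (fun x => act x s).

(** The averaged walk started at s on the fibre over x is the translate of the
    averaged walk started at 1 on the fibre over x.s. *)
Lemma dyadic_avg_translate (p : X -> S -> R) n x s mu :
  (forall y, is_prob (p y)) -> l1 mu ->
  dyadic_avg (push (fibre_kernel act p x)) n (translate s mu) =
  translate s (dyadic_avg (push (fibre_kernel act p (act x s))) n mu).
Proof.
move=> pp lmu.
have lp y : l1 (p y) by exact: prob_l1.
have p1 y : l1norm (p y) <= 1 by rewrite prob_l1norm.
have K1 y := fibre_kernel_bounded act y lp p1.
have itT k nu : l1 nu -> iter k (push (fibre_kernel act p x)) (translate s nu) =
    translate s (iter k (push (fibre_kernel act p (act x s))) nu).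
  move=> lnu; elim: k => //= k ->; apply: (push_fibre_translate actP x s lp p1).
  by apply: iter_stable => // r; exact: l1_push (K1 _).
have lavg n' : l1 (dyadic_avg (push (fibre_kernel act p (act x s))) n' mu).
  by apply: l1_dyadic_avg => // u; exact: fibre_kernel_prob.
elim: n => //= n ->; rewrite itT// translate_avg//.
by apply: iter_stable => // r; exact: l1_push (K1 _).
Qed.

Lemma liouville_uniform_reiter : liouville R act -> uniform_reiter R act.
Proof.
move=> [p [pp pc liou]].
have lp y : l1 (p y) by exact: prob_l1.
have p1 y : l1norm (p y) <= 1 by rewrite prob_l1norm.
have K1 y := fibre_kernel_bounded act y lp p1.
have Kp x := fibre_kernel_prob act x pp.
pose theta n x := dyadic_avg (push (fibre_kernel act p x)) n (delta 1%g).
have theta_prob n x : is_prob (theta n x).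
  apply: dyadic_avg_stable => [mu|mu nu mup nup|].
  - exact: push_prob.
  - have [m0 lm m1] := (iffLR (prob_mass _)) mup.
    have [n0 ln n1] := (iffLR (prob_mass _)) nup.
    apply/prob_mass; split.
    + by move=> s; rewrite mulr_ge0 ?invr_ge0 ?addr_ge0.
    + exact/l1Z/l1D.
    + rewrite rsumZ; last exact: l1D.
      by rewrite (rsumD lm ln) m1 n1; field.
  - exact: delta_prob.
have theta_l1 n x : l1 (theta n x) by exact: prob_l1.
have it_l1 k n x : l1 (iter k (push (fibre_kernel act p x)) (theta n x)).
  by apply: iter_stable => // r; exact: l1_push (K1 _).
have theta_cont n : l1_continuous (theta n).
  elim: n => [|n IH]; first exact: l1_continuous_cst.
  have itc k :
      l1_continuous (fun x => iter k (push (fibre_kernel act p x)) (theta n x)).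
    elim: k => //= k IHk.
    by apply: (l1_continuous_fibre act_cont lp p1 pc).
  apply: l1_continuousZ => [x|]; first by apply: l1D; [exact: theta_l1|exact: it_l1].
  exact: (l1_continuousD (theta_l1 n) (it_l1 (2 ^ n)%N n) IH (itc (2 ^ n)%N)).
exists theta; split=> // s; apply/family_compact_cvg0P => A cA e e0.
pose D n x := theta n x \- translate s (theta n (act x s)).
have DE n x :
    l1norm (theta n x \- ltranslate s (theta n (act x s))) = l1norm (D n x).
  by rewrite ltranslateE// => t; case: (theta_prob n (act x s)).
have Davg n x :
    D n x = dyadic_avg (push (fibre_kernel act p x)) n (delta 1%g \- delta s).
  rewrite dyadic_avgB//; [|exact: l1_delta..].
  rewrite /D /theta -dyadic_avg_translate//; last exact: l1_delta.
  by rewrite translate_delta mulg1.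
have Dl1 n x : l1 (D n x) by apply: l1B => //; exact: l1_translate.
have Dcont n : l1_continuous (D n).
  apply: l1_continuousB => // [x|]; first exact: l1_translate.
  exact: l1_continuous_translate.
have ld : l1 (delta 1%g \- delta s : S -> R) by apply: l1B; exact: l1_delta.
have Dhomo m n x : (m <= n)%N -> l1norm (D n x) <= l1norm (D m x).
  by move=> mn; rewrite !Davg; exact: l1norm_dyadic_avg_homo.
have D0 x : exists n, l1norm (D n x) < e.
  have : exists n, l1norm (dyadic_avg (push (fibre_kernel act p x)) n
      (delta 1%g \- delta s)) < e.
    apply: dyadic_avg_cvg0 => //.
    - move=> g c gc gP.
      pose f t : R[i] := ((g t)%:C)%C.
      have fc t : `|f t| <= (c%:C)%C.
        by rewrite normc_def /= expr0n/= addr0 sqrtr_sqr lecR.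
      have hf : Defs.harmonic act p x f.
        apply/(harmonicP act x lp fc); split=> r /=; first exact: gP.
        by rewrite /pull; under eq_rsum do rewrite mulr0; rewrite rsum0.
      have [d hd] := liou x f (ex_intro _ c fc) hf.
      by exists (complex.Re d) => t; rewrite -(hd t).
    - rewrite rsumB ?(prob_rsum (delta_prob _)) ?subrr//; exact: l1_delta.
  by move=> [n]; exists n; rewrite Davg.
(* Dini: smallness at one index persists nearby by continuity, and then at all
   larger indices by monotonicity. *)
have near2 x : A x -> \forall x' \near x & n \near \oo, l1norm (D n x') < e.
  move=> _; have [N hN] := D0 x.
  have := l1_continuous_norm (Dl1 N) (Dcont N) hN => near1.
  exists ([set x' | l1norm (D N x') < e], [set n | (N <= n)%N]) => /=.
    by split => //; exists N.
  by move=> [x' n] /= [h Nn]; exact: le_lt_trans (Dhomo _ _ _ Nn) h.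
have := (iffLR (compact_near_coveringP A)) cA nat \oo _ _ near2.
move=> /(_ _)/filterS; apply => n An x Ax.
by rewrite DE ger0_norm ?l1norm_ge0//; exact: An.
Qed.

End liouville_reiter.

(** * Expected visits of a killed chain *)

Section green.
Context {R : realType} {S : choiceType}.
Variables (B : S -> S -> R) (b : R).
Hypothesis Bb : forall s, has_mass b (B s).

(** The sum of B^j mu over j < n: when the rows of B have mass b, the chain is
    killed with probability 1 - b at each step, and [green n mu] counts the
    expected visits before time n of the chain started with law mu. *)
Fixpoint green n (mu : S -> R) : S -> R :=
  if n is n'.+1 then fun s => green n' mu s + iter n' (push B) mu s else fun=> 0.

Fixpoint geom n : R := if n is n'.+1 then geom n' + b ^+ n' else 0.

Lemma geomE n : (1 - b) * geom n = 1 - b ^+ n.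
Proof.
elim: n => [|n IH] /=; first by rewrite mulr0 expr0 subrr.
by rewrite mulrDr IH exprS; ring.
Qed.

Lemma iter_push_mass n mu : has_mass 1 mu -> has_mass (b ^+ n) (iter n (push B) mu).
Proof.
move=> mu1; elim: n => [|n IH] //=.
by rewrite exprSr; exact: push_mass.
Qed.

Lemma green_mass n mu : has_mass 1 mu -> has_mass (geom n) (green n mu).
Proof.
move=> mu1; elim: n => [|n [g0 lg gm]] /=.
  by split => //; [exact: l10|exact: rsum0].
have [i0 li im] := iter_push_mass n mu1.
by split; [move=> s; rewrite addr_ge0|exact: l1D|rewrite rsumD// gm im].
Qed.

(** Since f = h + P f with h = f - P f, iterating n times gives
    f = h + P h + ... + P^(n-1) h + P^n f. *)
Lemma green_pairing n mu f c : has_mass 1 mu -> (forall s, `|f s| <= c) ->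
  rsum (fun s => mu s * f s) =
  rsum (fun s => green n mu s * (f s - pull B f s)) +
  rsum (fun s => iter n (push B) mu s * f s).
Proof.
move=> mu1 fc.
have Bm := mass_kernel Bb.
have Pfc s : `|pull B f s| <= c * b.
  have [g0 lg gm] := Bb s.
  by apply: le_trans (norm_rsumM lg fc) _; rewrite (has_mass_l1norm (Bb s)).
elim: n => [|n ->] /=.
  by under [X in _ = X + _]eq_rsum do rewrite mul0r; rewrite rsum0 add0r.
have [g0 lg gm] := green_mass n mu1.
have [i0 li im] := iter_push_mass n mu1.
have hc s : `|f s - pull B f s| <= c + c * b.
  by apply: le_trans (ler_normB _ _) _; exact: lerD.
rewrite (push_pull Bm li fc).
under [X in _ = rsum X + _]eq_fun do rewrite mulrDl.
rewrite rsumD; [|exact: l1M hc lg|exact: l1M hc li].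
rewrite -addrA; congr (_ + _).
rewrite -rsumD; [|exact: l1M hc li|exact: l1M Pfc li].
by apply: eq_rsum => s; ring.
Qed.

(** Replace h by the constant h(a) in <G, h>.  The price is d on E and d' outside
    of E, where G has mass at most e.  The resulting multiple of h(a) is the mass
    of G, which depends on b and n only. *)
Lemma green_estimate n a f M (E : pred S) d d' e : 0 <= d -> 0 <= d' ->
  (forall s, `|f s| <= M) ->
  let h s := f s - pull B f s in
  (forall u, E u -> `|h u - h a| <= d) -> (forall u, `|h u - h a| <= d') ->
  rsum (fun u => if E u then 0 else green n (delta a) u) <= e ->
  `|f a - geom n * h a| <= b ^+ n * M + geom n * d + d' * e.
Proof.
move=> d0 d'0 fM h hE hd' tail.
have da := (iffLR (prob_mass _)) (delta_prob a : is_prob (delta a : S -> R)).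
have [g0 lg gm] := green_mass n da.
have [i0 li im] := iter_push_mass n da.
have E0 : f a - geom n * h a =
    rsum (fun u => green n (delta a) u * (h u - h a)) +
    rsum (fun u => iter n (push B) (delta a) u * f u).
  rewrite -[in LHS](rsum_delta a f) (green_pairing n da fM) -gm.
  rewrite (_ : rsum (fun u => green n (delta a) u * (h u - h a)) =
    rsum (fun u => green n (delta a) u * h u) - rsum (green n (delta a)) * h a).
    by rewrite /h; ring.
  rewrite -rsumZr// -rsumB.
  - by apply: eq_rsum => u; rewrite mulrBr.
  - apply: (@l1M _ _ h (M + M * b)) => // s.
    apply: le_trans (ler_normB _ _) _; apply: lerD => //.
    have [B0 lB Bm] := Bb s.
    by apply: le_trans (norm_rsumM lB fM) _; rewrite (has_mass_l1norm (Bb s)).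
  - exact: l1Zr.
rewrite E0; apply: le_trans (ler_normD _ _) _.
rewrite -addrA addrC; apply: lerD; last first.
  apply: le_trans (norm_rsumM li fM) _.
  by rewrite (has_mass_l1norm (iter_push_mass n da)) mulrC.
apply: le_trans (norm_rsum (l1M hd' lg)) _; rewrite l1normE.
have lt : l1 (fun u => if E u then 0 else green n (delta a) u).
  by apply: le_l1 lg => u; case: ifP => // _; rewrite normr0.
apply: (@le_trans _ _ (rsum (fun u => d * green n (delta a) u +
    d' * (if E u then 0 else green n (delta a) u)))).
  apply: le_rsum => [||u].
  - exact/l1_norm/(l1M hd' lg).
  - by apply: l1D; exact: l1Z.
  - rewrite normrM (ger0_norm (g0 u)); case: ifPn => Eu.
      by rewrite mulr0 addr0 mulrC ler_wpM2r// hE.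
    rewrite mulrC; apply: (@le_trans _ _ (d' * green n (delta a) u)).
      by rewrite ler_wpM2r.
    by rewrite lerDr mulr_ge0.
rewrite rsumD; try exact: l1Z.
rewrite !rsumZ// gm mulrC lerD2l.
by rewrite ler_wpM2l.
Qed.

End green.

(** * Mixtures of almost invariant families *)

Section mixture.
Context {R : realType} {X : topologicalType} {S : monoidType}.
Variable act : X -> S -> X.
Hypothesis actP : is_right_action act.

Definition mixture (w : nat -> R) (alpha : nat -> X -> S -> R) (x : X) : S -> R :=
  push (fun k => alpha k x) w.

Implicit Types (w : nat -> R) (alpha : nat -> X -> S -> R) (f : S -> R).

Lemma mixture_mass w alpha c x : (forall k y, is_prob (alpha k y)) ->
  has_mass c w -> has_mass c (mixture w alpha x).
Proof.
move=> ap wc; rewrite -[c]mulr1; apply: push_mass => // k.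
exact/prob_mass.
Qed.

Lemma mixture_continuous w alpha : (forall k y, is_prob (alpha k y)) ->
  (forall k, l1_continuous (alpha k)) -> l1 w -> l1_continuous (mixture w alpha).
Proof.
move=> ap ac lw.
apply: (@l1_continuous_push _ _ _ _ 1 (fun x k => alpha k x) (fun _ => w)) => //.
- by move=> x; exact: prob_kernel.
- exact: l1_continuous_cst.
Qed.

Lemma pull_mixture w alpha c x f M u : (forall k y, is_prob (alpha k y)) ->
  has_mass c w -> (forall t, `|f t| <= M) ->
  pull (fibre_kernel act (mixture w alpha) x) f u =
  rsum (fun k => w k * pull (fibre_kernel act (alpha k) x) f u).
Proof.
move=> ap wc fM; have [w0 lw _] := wc.
rewrite (@pull_fibre _ _ _ act _ x f M u)//; last first.
  by move=> y; case: (mixture_mass y ap wc).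
have fMu t : `|f (u * t)%g| <= M by [].
rewrite /mixture (@push_pull _ _ _ _ 1 w _ M _ lw fMu); last first.
  by exact: prob_kernel.
apply: eq_rsum => k; rewrite (@pull_fibre _ _ _ act _ x f M u)// => y.
exact: prob_l1.
Qed.

(** The rows of the fibre kernel at 1 and at u are p_x and u p_(x.u). *)
Lemma pull_fibre_variation (p : X -> S -> R) x f M u : (forall y, is_prob (p y)) ->
  (forall t, `|f t| <= M) ->
  `|pull (fibre_kernel act p x) f u - pull (fibre_kernel act p x) f 1%g| <=
  M * l1norm (p x \- translate u (p (act x u))).
Proof.
move=> pp fM; have lp y : l1 (p y) by exact: prob_l1.
have lt v : l1 (fibre_kernel act p x v) by exact: l1_translate.
rewrite distrC /pull -rsumB; [|exact: l1M fM (lt _)..].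
have -> : p x = fibre_kernel act p x 1%g.
  rewrite /fibre_kernel (proj1 actP); apply: pairing_ext => g g1.
  rewrite (translate_pairing _ (lp _) g1).
  by apply: eq_rsum => t; rewrite mul1g.
rewrite (_ : rsum _ = rsum (fun t =>
    (fibre_kernel act p x 1%g \- fibre_kernel act p x u) t * f t)).
  by apply: norm_rsumM => //; exact: l1B.
by apply: eq_rsum => t /=; rewrite mulrBl.
Qed.

Definition weight (k : nat) : R := 2^-1 ^+ k.+1.
Definition weight_lt m k : R := if (k < m)%N then weight k else 0.
Definition weight_ge m k : R := if (k < m)%N then 0 else weight k.

Lemma weight_gt0 k : 0 < weight k.
Proof. by rewrite /weight exprn_gt0// invr_gt0. Qed.

Lemma weight_mass : has_mass 1 weight.
Proof.
apply/prob_mass; split=> [k|]; first exact/ltW/weight_gt0.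
rewrite -nneseries_esumT => [|k]; last by rewrite lee_fin ltW// weight_gt0.
have half : `|2^-1 : R| < 1 by rewrite ger0_norm ?invr_ge0// invf_lt1// ltr1n.
have := @cvg_geometric_series R (2^-1) _ half.
have -> : series (geometric (2^-1 : R) 2^-1) = series weight.
  by congr series; apply/funext => k; rewrite /geometric /weight /= exprS.
have -> : (2^-1 : R) / (1 - 2^-1) = 1 by field; lra.
move=> h; apply/cvg_lim => //.
rewrite (_ : (fun n => _) = EFin \o series weight).
  by apply: cvg_EFin => //; apply: nearW.
by apply/funext => n /=; rewrite /series /= sumEFin.
Qed.

Definition mass_lt m : R := rsum (weight_lt m).

Lemma weight_lt_mass m : has_mass (mass_lt m) (weight_lt m).
Proof.
have [w0 lw _] := weight_mass; split => //.
  by move=> k; rewrite /weight_lt; case: ifP.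
by apply: le_l1 lw => k; rewrite /weight_lt; case: ifP; rewrite // normr0.
Qed.

Lemma weight_ge_mass m : has_mass (1 - mass_lt m) (weight_ge m).
Proof.
have [w0 lw w1] := weight_mass; have [v0 lv _] := weight_lt_mass m.
have lg : l1 (weight_ge m).
  by apply: le_l1 lw => k; rewrite /weight_ge; case: ifP; rewrite // normr0.
split => //; first by move=> k; rewrite /weight_ge; case: ifP.
rewrite -w1 /mass_lt -rsumB//; apply: eq_rsum => k.
by rewrite /weight_ge /weight_lt; case: ifP; rewrite ?subrr ?subr0.
Qed.

Lemma mass_lt1 m : 0 <= mass_lt m < 1.
Proof.
have [w0 lw w1] := weight_lt_mass m; have [v0 lv v1] := weight_ge_mass m.
apply/andP; split; first exact: rsum_ge0.
rewrite -subr_gt0 -v1; apply: lt_le_trans (le_rsum_point m v0 lv).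
by rewrite /weight_ge ltnn weight_gt0.
Qed.

Variable alpha : nat -> X -> S -> R.
Hypothesis alpha_prob : forall k y, is_prob (alpha k y).

Let p := mixture weight alpha.
Let head m := mixture (weight_lt m) alpha.

Lemma fibre_head_mass m x u : has_mass (mass_lt m) (fibre_kernel act (head m) x u).
Proof.
rewrite -[mass_lt m]mulr1; apply: push_mass.
  by move=> t; apply/prob_mass; exact: delta_prob.
by apply: mixture_mass => //; exact: weight_lt_mass.
Qed.

Lemma harmonic_defect m x f M u : (forall t, `|f t| <= M) ->
  (forall r, f r = pull (fibre_kernel act p x) f r) ->
  f u - pull (fibre_kernel act (head m) x) f u =
  rsum (fun k => weight_ge m k * pull (fibre_kernel act (alpha k) x) f u).
Proof.
move=> fM fh; have e1 := pull_mixture x u alpha_prob weight_mass fM.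
have e2 := pull_mixture x u alpha_prob (weight_lt_mass m) fM.
rewrite {1}fh {}e1 {}e2.
have [w0 lw w1] := weight_mass; have [v0 lv _] := weight_lt_mass m.
have bP k : `|pull (fibre_kernel act (alpha k) x) f u| <= M.
  apply: le_trans (norm_rsumM _ fM) _.
    exact/prob_l1/fibre_kernel_prob.
  by rewrite prob_l1norm ?mulr1//; exact: fibre_kernel_prob.
rewrite -rsumB; [|exact: l1M bP lw|exact: l1M bP lv].
apply: eq_rsum => k; rewrite -mulrBl; congr (_ * _).
by rewrite /weight_lt /weight_ge; case: ifP; rewrite ?subrr ?subr0.
Qed.

Lemma harmonic_defect_variation m x f M u e : 0 <= M -> (forall t, `|f t| <= M) ->
  (forall r, f r = pull (fibre_kernel act p x) f r) ->
  (forall k, (m <= k)%N ->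
     l1norm (alpha k x \- translate u (alpha k (act x u))) <= e) ->
  let h r := f r - pull (fibre_kernel act (head m) x) f r in
  `|h u - h 1%g| <= (1 - mass_lt m) * (M * e).
Proof.
move=> M0 fM fh inv /=; rewrite !(harmonic_defect m _ fM fh).
have bP v k : `|pull (fibre_kernel act (alpha k) x) f v| <= M.
  apply: le_trans (norm_rsumM _ fM) _.
    exact/prob_l1/fibre_kernel_prob.
  by rewrite prob_l1norm ?mulr1//; exact: fibre_kernel_prob.
have [v0 lv v1] := weight_ge_mass m.
rewrite -rsumB; [|exact: l1M (bP _) lv..].
have ld : l1 (fun k => weight_ge m k * pull (fibre_kernel act (alpha k) x) f u -
    weight_ge m k * pull (fibre_kernel act (alpha k) x) f 1%g).
  by apply: l1B; exact: l1M (bP _) lv.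
apply: le_trans (norm_rsum ld) _; rewrite -v1 -rsumZr// l1normE.
apply: le_rsum => [||k]; [exact: l1_norm|exact: l1Zr|].
rewrite -mulrBr normrM (ger0_norm (v0 k)) /weight_ge.
case: ltnP => km; first by rewrite !mul0r.
rewrite ler_wpM2l ?(ltW (weight_gt0 _))//.
apply: le_trans (pull_fibre_variation x u (alpha_prob k) fM) _.
by rewrite ler_wpM2l// inv.
Qed.

Let headG m n x := green (fibre_kernel act (head m) x) n (delta 1%g).

(** The three error terms of [green_estimate] are M e for the surviving part of the
    chain, M e for the variation of the defect on E, where the mass of G cancels
    the factor 1 - b, and 2 M e for the part of G outside of E. *)
Lemma mixture_point_estimate m n x f M (E : pred S) e :
  0 <= M -> (forall t, `|f t| <= M) -> 0 <= e ->
  (forall r, f r = pull (fibre_kernel act p x) f r) ->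
  (forall k u, (m <= k)%N -> E u ->
    l1norm (alpha k x \- translate u (alpha k (act x u))) <= e) ->
  rsum (fun u => if E u then 0 else headG m n x u) <= e ->
  mass_lt m ^+ n <= e ->
  `|f 1%g - geom (mass_lt m) n * (f 1%g - pull (fibre_kernel act (head m) x) f 1%g)|
    <= 4 * M * e.
Proof.
move=> M0 fM e0 fh inv tail ne.
have /andP[b0 b1] := mass_lt1 m.
have t0 : 0 <= 1 - mass_lt m by lra.
have inv2 u k : (m <= k)%N ->
    l1norm (alpha k x \- translate u (alpha k (act x u))) <= 2.
  move=> _; apply: le_trans (l1normB _ _) _.
  - exact: prob_l1.
  - exact/prob_l1/translate_prob.
  - rewrite (prob_l1norm (alpha_prob k x)).
    by rewrite (prob_l1norm (translate_prob u (alpha_prob k (act x u)))); lra.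
have := @green_estimate _ _ _ _ (fibre_head_mass m x) n 1%g f M E
  ((1 - mass_lt m) * (M * e)) ((1 - mass_lt m) * (M * 2)) e.
move=> /(_ _ _ fM) est; apply: le_trans (est _ _ _ _ tail) _.
- by rewrite !mulr_ge0.
- by rewrite !mulr_ge0.
- by move=> u Eu; apply: harmonic_defect_variation => // k mk; exact: inv.
- by move=> u; apply: harmonic_defect_variation => // k mk; exact: inv2.
have g1 : geom (mass_lt m) n * (1 - mass_lt m) <= 1.
  by rewrite mulrC geomE gerBl exprn_ge0.
have -> : geom (mass_lt m) n * ((1 - mass_lt m) * (M * e)) =
  (geom (mass_lt m) n * (1 - mass_lt m)) * (M * e) by ring.
have Me : 0 <= M * e by rewrite mulr_ge0.
have h1 : mass_lt m ^+ n * M <= M * e by rewrite mulrC ler_wpM2l.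
have h2 : geom (mass_lt m) n * (1 - mass_lt m) * (M * e) <= M * e.
  by rewrite ler_piMl.
have h3 : (1 - mass_lt m) * (M * 2) * e <= 2 * (M * e).
  rewrite (_ : _ * (M * 2) * e = (1 - mass_lt m) * (2 * (M * e))); last by ring.
  by rewrite ler_piMl ?mulr_ge0//; lra.
lra.
Qed.

(** [mixture_point_estimate] is used at 1 on the fibre over x, and for the function
    t |-> f(s t) on the fibre over x.s, whose defect at 1 is the defect of f at s.
    Hence 9 = 4 + 4 + 1. *)
Lemma mixture_oscillation m n x f M s (E : pred S) e :
  0 <= M -> (forall t, `|f t| <= M) -> 0 <= e ->
  (forall r, f r = pull (fibre_kernel act p x) f r) ->
  (forall y k u, y = x \/ y = act x s -> (m <= k)%N -> E u ->
    l1norm (alpha k y \- translate u (alpha k (act y u))) <= e) ->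
  (forall y, y = x \/ y = act x s ->
    rsum (fun u => if E u then 0 else headG m n y u) <= e) ->
  mass_lt m ^+ n <= e -> E s ->
  `|f s - f 1%g| <= 9 * M * e.
Proof.
move=> M0 fM e0 fh inv tail ne Es.
have hx := mixture_point_estimate M0 fM e0 fh
  (fun k u mk Eu => inv x k u (or_introl erefl) mk Eu) (tail x (or_introl erefl)) ne.
pose g t := f (s * t)%g.
have gM t : `|g t| <= M by exact: fM.
have pullg (q : X -> S -> R) u : (forall y, l1 (q y)) ->
    pull (fibre_kernel act q (act x s)) g u = pull (fibre_kernel act q x) f (s * u)%g.
  move=> lq; rewrite (pull_fibre _ _ _ lq gM) (pull_fibre _ _ _ lq fM) (proj2 actP).
  by apply: eq_rsum => t; rewrite /g mulgA.
have lpp y : l1 (p y) by case: (mixture_mass y alpha_prob weight_mass).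
have lh k y : l1 (head k y) by case: (mixture_mass y alpha_prob (weight_lt_mass k)).
have gh r : g r = pull (fibre_kernel act p (act x s)) g r.
  by rewrite (pullg p r lpp); exact: fh.
have hs := mixture_point_estimate M0 gM e0 gh
  (fun k u mk Eu => inv _ k u (or_intror erefl) mk Eu) (tail _ (or_intror erefl)) ne.
have := @harmonic_defect_variation m x f M s e M0 fM fh
  (fun k mk => inv x k s (or_introl erefl) mk Es).
move: hx hs; rewrite (pullg _ 1%g (lh m)) /g !mulg1 /=.
set h1 := f 1%g - pull _ _ _; set h2 := f s - pull _ _ _ => hx hs hd.
have /andP[b0 b1] := mass_lt1 m.
have gm0 : 0 <= geom (mass_lt m) n.
  have := geomE (mass_lt m) n => gE.
  have : 0 <= (1 - mass_lt m) * geom (mass_lt m) n.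
    by rewrite gE subr_ge0 exprn_ile1// ltW.
  by rewrite pmulr_rge0// subr_gt0.
have g1 : geom (mass_lt m) n * (1 - mass_lt m) <= 1.
  by rewrite mulrC geomE gerBl exprn_ge0.
have hd' : `|geom (mass_lt m) n * h2 - geom (mass_lt m) n * h1| <= M * e.
  rewrite -mulrBr normrM ger0_norm//.
  apply: le_trans (ler_wpM2l gm0 hd) _; rewrite mulrA ler_piMl// mulr_ge0//.
move: hx hs hd'.
set A := geom _ _ * h1; set A' := geom _ _ * h2.
rewrite !ler_norml; lra.
Qed.

End mixture.

(** * From uniform Reiter to Liouville *)

Lemma compact_exhaustion (X : topologicalType) :
  locally_compact [set: X] -> @second_countable X ->
  exists C : nat -> set X, [/\ forall n, compact (C n),
    forall m n, (m <= n)%N -> C m `<=` C n & forall x, exists n, C n x].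
Proof.
move=> lc [B /countable_injP[i inji] [Bo Bb]].
have : forall n, exists K : set X, compact K /\
    (forall U, B U -> i U = n -> (exists2 V, compact V & U `<=` V) -> U `<=` K).
  move=> n; have [[U [BU iU [V cV UV]]]|noU] :=
      pselect (exists U, [/\ B U, i U = n & exists2 V, compact V & U `<=` V]).
    exists V; split=> // W BW iW _.
    by rewrite (inji _ _ (mem_set BW) (mem_set BU) (etrans iW (esym iU))).
  by exists set0; split; [exact: compact0|move=> U BU iU hU; case: noU; exists U].
move=> /choice[K KP].
exists (fun n => \big[setU/set0]_(k < n.+1) K k); split.
- by move=> n; apply: bigsetU_compact => k _; case: (KP k).
- move=> m n mn x; rewrite -!bigcup_mkord => -[k /= km Kx].
  by exists k => //=; exact: leq_trans km _.
- move=> x; have [V Vx [cV _]] := lc x I.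
  have Vx' : nbhs x V by move: Vx; rewrite /within/= => /filterS; apply=> y; exact.
  have [U [BU Ux] UV] := Bb x V Vx'.
  exists (i U); rewrite -bigcup_mkord; exists (i U) => //=.
  by case: (KP (i U)) => _ /(_ U BU erefl); apply=> //; exists V.
Qed.

(** Recursive choice of a sequence each term of which may depend on all the
    previous ones. *)
Lemma history_choice (T : Type) (Q : seq T -> T -> Prop) :
  (forall l, exists a, Q l a) ->
  exists a : nat -> T, forall m, Q (mkseq a m) (a m).
Proof.
move=> /choice[c cQ].
pose L := fix L m := if m is m'.+1 then rcons (L m') (c (L m')) else [::].
exists (fun m => c (L m)) => m.
have -> : mkseq (fun m => c (L m)) m = L m by elim: m => // m IH; rewrite mkseqS IH.
exact: cQ.
Qed.

(** Tightness is uniform on compact sets: at a given point the tails beyond n tend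
    to 0, and l1-continuity carries the estimate to a neighbourhood.  The sets
    of small code stand for the finite sets of an exhaustion of S. *)
Lemma l1_tight (R : realType) (X : topologicalType) (S : choiceType)
    (code : S -> nat) (p : X -> S -> R) (A : set X) (e : R) :
  (forall x s, 0 <= p x s) -> (forall x, l1 (p x)) -> l1_continuous p ->
  compact A -> 0 < e ->
  exists N, forall x, A x ->
    rsum (fun s => if (code s < N)%N then 0 else p x s) <= e.
Proof.
move=> p0 lp /l1_continuousP pc cA e0.
pose a (n : nat) (s : S) : R := if (code s < n)%N then 0 else 1.
have a1 n s : `|a n s| <= 1 by rewrite /a; case: ifP; rewrite ?normr0 ?normr1.
have tailE n x : rsum (fun s => if (code s < n)%N then 0 else p x s) =
    rsum (fun s => p x s * a n s).
  by apply: eq_rsum => s; rewrite /a; case: ifP; rewrite ?mulr0 ?mulr1.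
have e2 : 0 < e / 2 by rewrite divr_gt0.
have near2 x : A x -> \forall x' \near x & n \near \oo,
    rsum (fun s => p x' s * a n s) <= e.
  move=> _; have near1 := pc x _ e2.
  have : rsum (fun s => p x s * a n s) @[n --> \oo] --> (0 : R).
    apply: (@dominated_rsum _ _ _ _ _ _ 1) => // s.
    apply: cvg_near_cst; exists (code s).+1 => // n /= sn.
    by rewrite /a sn.
  move=> /cvgr0Pnorm_le/(_ _ e2) near2.
  exists ([set x' | l1norm (p x' \- p x) <= e / 2],
    [set n | `|rsum (fun s => p x s * a n s)| <= e / 2]) => //=.
  move=> [x' n] /= [h1 h2].
  have -> : rsum (fun s => p x' s * a n s) =
      rsum (fun s => (p x' \- p x) s * a n s) + rsum (fun s => p x s * a n s).
    rewrite -rsumD; last 2 first.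
    - exact: l1M (a1 n) (l1B (lp _) (lp _)).
    - exact: l1M (a1 n) (lp x).
    by apply: eq_rsum => s /=; ring.
  have h3 := norm_rsumM (l1B (lp x') (lp x)) (a1 n).
  move: h2 h3; rewrite mul1r !ler_norml => /andP[_ h2] /andP[_ h3].
  move: h1 h2 h3; set u := rsum _; set v := rsum _; set z := l1norm _; lra.
have cov := (iffLR (compact_near_coveringP A)) cA nat \oo _ _ near2.
have [n An] := filter_ex (cov _).
by exists n => x Ax; rewrite tailE; exact: An.
Qed.

Section reiter_liouville.
Context {R : realType} {X : topologicalType} {S : monoidType}.
Variable act : X -> S -> X.
Hypothesis actP : is_right_action act.
Hypothesis act_cont : forall s, continuous (fun x => act x s).

Lemma green_continuous (p : X -> S -> R) b n : (forall y, has_mass b (p y)) ->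
  l1_continuous p ->
  l1_continuous (fun x => green (fibre_kernel act p x) n (delta 1%g)).
Proof.
move=> pb pc.
have lp y : l1 (p y) by case: (pb y).
have pm y : l1norm (p y) <= b by rewrite (has_mass_l1norm (pb y)).
have Kb x u : has_mass b (fibre_kernel act p x u).
  rewrite -[b]mulr1; apply: push_mass => // t; exact/prob_mass/delta_prob.
have d1 : has_mass 1 (delta 1%g : S -> R) by exact/prob_mass/delta_prob.
have li k x : l1 (iter k (push (fibre_kernel act p x)) (delta 1%g)).
  by case: (iter_push_mass (Kb x) k d1).
have lg k x : l1 (green (fibre_kernel act p x) k (delta 1%g)).
  by case: (green_mass (Kb x) k d1).
have ic k : l1_continuous (fun x => iter k (push (fibre_kernel act p x)) (delta 1%g)).
  elim: k => [|k IH] /=; first exact: l1_continuous_cst.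
  exact: (l1_continuous_fibre act_cont lp pm pc (li k) IH).
elim: n => [|n IH]; first exact: l1_continuous_cst.
exact: (l1_continuousD (lg n) (li n) IH (ic n)).
Qed.

Lemma uniform_reiter_liouville : locally_compact [set: X] -> @second_countable X ->
  countable [set: S] -> uniform_reiter R act -> liouville R act.
Proof.
move=> lcX scX /countable_injP[code code_inj] [theta [tp tc tinv]].
have [C [Cc Cm CX]] := compact_exhaustion lcX scX.
have {tinv} inv s A e : compact A -> 0 < e -> \forall n \near \oo, forall x, A x ->
    l1norm (theta n x \- translate s (theta n (act x s))) < e.
  move=> cA e0; have := (iffLR (family_compact_cvg0P _)) (tinv s) A cA e e0.
  apply: filterS => n An x Ax; have := An x Ax.
  by rewrite ger0_norm ?l1norm_ge0// ltranslateE// => t; case: (tp n (act x s)).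
pose eps m : R := 2^-1 ^+ m.
have eps0 m : 0 < eps m by rewrite exprn_gt0// invr_gt0.
have eps_le m n : (m <= n)%N -> eps n <= eps m.
  by move=> mn; rewrite ler_wiXn2l// ?invr_ge0// invf_le1// ler1n.
have half : `|2^-1 : R| < 1 by rewrite ger0_norm ?invr_ge0// invf_lt1// ltr1n.
have : forall m, exists n, (mass_lt m : R) ^+ n <= eps m.
  move=> m; have /andP[b0 b1] := @mass_lt1 R m.
  have b1' : `|mass_lt m : R| < 1 by rewrite ger0_norm.
  have /cvgr0Pnorm_le/(_ _ (eps0 m))/filter_ex[n] := cvg_expr b1'.
  by rewrite ger0_norm ?exprn_ge0// => hn; exists n.
move=> /choice[steps stepsP].
(* A list l records the indices chosen so far; only its entries below its size
   enter in the head, so the default value of nth is harmless. *)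
pose alpha (l : seq nat) k := theta (nth 0%N l k).
pose head (l : seq nat) := mixture (weight_lt (size l)) (alpha l).
pose G (l : seq nat) x :=
  green (fibre_kernel act (head l) x) (steps (size l)) (delta 1%g).
have headmass l y : has_mass (mass_lt (size l)) (head l y).
  by apply: mixture_mass; [move=> k z; exact: tp|exact: weight_lt_mass].
have d1 : has_mass 1 (delta 1%g : S -> R) by exact/prob_mass/delta_prob.
have Gmass l x : has_mass (geom (mass_lt (size l)) (steps (size l))) (G l x).
  apply: green_mass => // u; apply: fibre_head_mass => k z; exact: tp.
have Gc l : l1_continuous (G l).
  have mc : l1_continuous (head l).
    apply: mixture_continuous.
    - by move=> k y; exact: tp.
    - by move=> k; exact: tc.
    - by case: (@weight_lt_mass R (size l)).
  exact: (green_continuous (steps (size l)) (headmass l) mc).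
have : forall l, exists N, forall x, C (size l) x ->
    rsum (fun s => if (code s < N)%N then 0 else G l x s) <= eps (size l).
  move=> l; apply: l1_tight => //.
  - by move=> x; case: (Gmass l x).
  - by move=> x; case: (Gmass l x).
move=> /choice[phi phiP].
(* The maximum over all prefixes of l makes later terms almost invariant under the
   finite sets of all earlier stages; the entry j makes these sets exhaust S. *)
pose Phi l := (\max_(j < (size l).+1) maxn j (phi (take j l)))%N.
pose Q l N := forall x u, C (size l) x -> (code u < Phi l)%N ->
  l1norm (theta N x \- translate u (theta N (act x u))) <= eps (size l).
have Qex l : exists N, Q l N.
  suff : forall b, \forall N \near \oo,
      forall x u, C (size l) x -> (code u < b)%N ->
      l1norm (theta N x \- translate u (theta N (act x u))) <= eps (size l).
    by move=> /(_ (Phi l))/filter_ex.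
  elim=> [|b IH]; first by apply: nearW => N x u.
  have [[v vb]|nov] := pselect (exists v, code v = b).
    apply: filterS2 IH (inv v _ _ (Cc (size l)) (eps0 (size l))) => N h1 h2 x u Cx.
    rewrite ltnS leq_eqVlt => /predU1P[ub|]; last exact: h1.
    rewrite (code_inj _ _ (mem_set I) (mem_set I) (etrans ub (esym vb))).
    by apply: ltW; exact: h2.
  apply: filterS IH => N h1 x u Cx; rewrite ltnS leq_eqVlt => /predU1P[ub|].
    by case: nov; exists u.
  exact: h1.
have [N NQ] := history_choice Qex.
pose beta k := theta (N k).
have bp k y : is_prob (beta k y) by exact: tp.
have bc k : l1_continuous (beta k) by exact: tc.
have [w0 lw w1] := @weight_mass R.
pose p := mixture (@weight R) beta.
have pp x : is_prob (p x) by apply/prob_mass/mixture_mass => //; exact: weight_mass.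
exists p; split => //; first exact: mixture_continuous.
move=> x f [M fM].
have headE m : mixture (weight_lt m) beta =
    mixture (weight_lt m) (alpha (mkseq N m)) :> (X -> S -> R).
  apply/funext => y; apply/funext => s; apply: eq_rsum => k.
  rewrite /weight_lt; case: ifP => km; last by rewrite !mul0r.
  by rewrite /alpha nth_mkseq.
(* The oscillation estimate holds at every stage m at which both x and x.s lie in
   the compact set C m and s lies in the finite set of this stage. *)
have key (g : S -> R) : (forall s, `|g s| <= M) ->
    (forall r, g r = pull (fibre_kernel act p x) g r) -> forall s, g s = g 1%g.
  move=> gM gh s.
  have M0 : 0 <= M by exact: le_trans (gM s).
  have bound : \forall m \near \oo, `|g s - g 1%g| <= 9 * M * eps m.
    have [m1 Cm1] := CX x; have [m2 Cm2] := CX (act x s).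
    near=> m.
    have m1m : (m1 <= m)%N by near: m; exists m1.
    have m2m : (m2 <= m)%N by near: m; exists m2.
    have sm : (code s < m)%N by near: m; exists (code s).+1.
    have Cy y : y = x \/ y = act x s -> C m y.
      by move=> [->|->]; [exact: Cm Cm1|exact: Cm Cm2].
    have PhiE k : Phi (mkseq N k) = (\max_(j < k.+1) maxn j (phi (mkseq N j)))%N.
      rewrite /Phi size_mkseq; apply: eq_bigr => j _.
      by rewrite /mkseq -map_take take_iota (minn_idPl _)// -ltnS.
    have Phi_ge k j : (j <= k)%N -> (maxn j (phi (mkseq N j)) <= Phi (mkseq N k))%N.
      move=> jk; rewrite PhiE; have jk' : (j < k.+1)%N by [].
      exact: (leq_bigmax (Ordinal jk')).
    apply: (@mixture_oscillation _ _ _ act actP beta bp m (steps m) x g M s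
      (fun u => (code u < Phi (mkseq N m))%N) (eps m)) => //.
    - exact: ltW.
    - move=> y k u yx mk um.
      apply: le_trans (eps_le _ _ mk).
      have := NQ k y u; rewrite size_mkseq; apply; first exact: Cm (Cy y yx).
      apply: leq_trans um _; rewrite !PhiE.
      apply/bigmax_leqP => j _; rewrite -PhiE; apply: Phi_ge.
      by apply: leq_trans mk; rewrite -ltnS.
    - move=> y yx; rewrite headE.
      have := phiP (mkseq N m) y; rewrite size_mkseq => /(_ (Cy y yx)).
      have [G0 lG _] := Gmass (mkseq N m) y.
      move: G0 lG; rewrite /G /head size_mkseq; set g' := green _ _ _ => G0 lG.
      apply: le_trans; apply: le_rsum => [||u].
      + by apply: le_l1 lG => u; case: ifP => // _; rewrite normr0.
      + by apply: le_l1 lG => u; case: ifP => // _; rewrite normr0.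
      + case: ifPn => um; case: ifPn => // um'.
        have := Phi_ge m m (leqnn m); rewrite geq_max => /andP[_ h].
        by rewrite (leq_trans um' h) in um.
    - apply: leq_trans sm _.
      by have := Phi_ge m m (leqnn m); rewrite geq_max => /andP[].
  have lim0 : 9 * M * eps m @[m --> \oo] --> (0 : R).
    rewrite -[X in _ --> X](mulr0 (9 * M)).
    by apply: cvgM; [exact: cvg_cst|exact: cvg_expr half].
  apply/eqP; rewrite -subr_eq0 -normr_le0.
  apply: (ler_cvg_to (cvg_cst _) lim0 bound).
have lp y : l1 (p y) by exact: prob_l1.
move=> /(harmonicP act x lp fM)[hr hi].
exists (f 1%g) => s.
have reM t : `|complex.Re (f t)| <= M by case: (norm_ReIm_le (fM t)).
have imM t : `|complex.Im (f t)| <= M by case: (norm_ReIm_le (fM t)).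
have := key _ reM hr s; have := key _ imM hi s.
by case: (f s) (f 1%g) => [a b] [c d] /= -> ->.
Unshelve. all: by end_near. Qed.

End reiter_liouville.

Theorem theorem6p7 (R : realType) (X : topologicalType) (S : monoidType)
    (act : X -> S -> X) :
  locally_compact [set: X] -> @second_countable X -> hausdorff_space X ->
  countable [set: S] ->
  is_right_action act -> (forall s : S, continuous (fun x => act x s)) ->
  liouville R act <-> uniform_reiter R act.
Proof.
move=> lcX scX _ cS actP act_cont; split.
  exact: liouville_uniform_reiter.
exact: uniform_reiter_liouville.
Qed.
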